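(* Let $f,g\in\mathbb{Z}[x,y]$ have no common non-constant factor, let $R^{(y)}=\operatorname{res}(f,g;y)\in\mathbb{Z}[x]$ and $R^{(x)}=\operatorname{res}(f,g;x)\in\mathbb{Z}[y]$. Let $\alpha$ be a real root of $R^{(y)}$ and $\beta$ a real root of $R^{(x)}$, with associated discs $\Delta(\alpha),\Delta(\beta)\subset\mathbb{C}$, lower bounds $L(\alpha),L(\beta)$ and polydisc $\Delta(\alpha,\beta)=\Delta(\alpha)\times\Delta(\beta)\subset\mathbb{C}^2$ constructed as described in the context, and let $U(\alpha,\beta,u^{(y)})$, $U(\alpha,\beta,v^{(y)})$, $U(\alpha,\beta,u^{(x)})$, $U(\alpha,\beta,v^{(x)})$ be upper bounds as in the context. If there exists $(x_0,y_0)\in\Delta(\alpha,\beta)$ with $$U(\alpha,\beta,u^{(y)})\,|f(x_0,y_0)|+U(\alpha,\beta,v^{(y)})\,|g(x_0,y_0)|<L(\alpha)$$ and $$U(\alpha,\beta,u^{(x)})\,|f(x_0,y_0)|+U(\alpha,\beta,v^{(x)})\,|g(x_0,y_0)|<L(\beta),$$ then $\Delta(\alpha,\beta)$ contains a common complex zero of $f$ and $g$, and $f(\alpha,\beta)=0$.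
   Context: Notation: for an interval $I=(a,b)\subset\mathbb{R}$, $m_I=(a+b)/2$ and $r_I=(b-a)/2$; $\Delta_r(m)=\{z\in\mathbb{C}:|z-m|<r\}$. For $p\in\mathbb{R}[x]$ and reals $m,r,K$, the predicate $T^p_K(m,r)$ means $|p(m)|-K\sum_{k\ge1}\left|\frac{p^{(k)}(m)}{k!}\right|r^k>0$. Construction of $\Delta(\alpha)$ and $L(\alpha)$: write $R^{(y)}=\prod_{i=1}^{\deg R^{(y)}} r_i^{\,i}$ with $r_i\in\mathbb{Z}[x]$ square-free and pairwise coprime (square-free factorization). If $\alpha$ is a root of $r_{i_0}$, let $I=I(\alpha)$ be an open real interval containing $\alpha$ such that $T^{(r_{i_0})'}_{3/2}(m_I,8r_I)$ holds and $T^{r_i}_1(m_I,8r_I)$ holds for all $i\neq i_0$; set $\Delta(\alpha):=\Delta_{2r_I}(m_I)$ and $L(\alpha):=2^{-i_0-\deg R^{(y)}}|R^{(y)}(m_I-2r_I)|$. $\Delta(\beta)$ and $L(\beta)$ are constructed in exactly the same way from $R^{(x)}$ and its square-free factorization. Cofactors: let $m_y=\deg_y f$, $n_y=\deg_y g$ and let $S^{(y)}(f,g)$ be the $(m_y+n_y)\times(m_y+n_y)$ Sylvester matrix of $f,g$ regarded as polynomials in $y$ (entries in $\mathbb{Z}[x]$), whose determinant is $R^{(y)}$. Let $u^{(y)}$ (resp. $v^{(y)}$) be the determinant of the matrix obtained from $S^{(y)}(f,g)$ by replacing its last column by $(y^{n_y-1},\dots,y,1,0,\dots,0)^T$ (resp.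 $(0,\dots,0,y^{m_y-1},\dots,y,1)^T$); then $u^{(y)},v^{(y)}\in\mathbb{Z}[x,y]$ and $R^{(y)}=u^{(y)}f+v^{(y)}g$. The cofactors $u^{(x)},v^{(x)}$ with $R^{(x)}=u^{(x)}f+v^{(x)}g$ are defined analogously with the roles of $x$ and $y$ exchanged. The quantities $U(\alpha,\beta,u^{(y)})$ etc. are real numbers such that $|u^{(y)}(z_1,z_2)|\le U(\alpha,\beta,u^{(y)})$ for all $(z_1,z_2)$ in the closure of $\Delta(\alpha,\beta)$, and likewise for $v^{(y)},u^{(x)},v^{(x)}$. *)

(* Defs.v *)
From HB Require Import structures.
From mathcomp Require Import all_boot all_order all_algebra.
From mathcomp Require Import reals.
From mathcomp.real_closed Require Import complex.
Set Implicit Arguments. Unset Strict Implicit. Unset Printing Implicit Defensive.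
Import Order.TTheory GRing.Theory Num.Theory.
Local Open Scope ring_scope.
Local Open Scope complex_scope.

(* Bivariate integer polynomials: f : {poly {poly int}} is f = sum_j f_j(x) y^j,
   i.e. the OUTER variable is y and the INNER variable is x. *)

Definition eval2 (T : comNzRingType) (f : {poly {poly int}}) (x0 y0 : T) : T :=
  ((map_poly (map_poly (intr : int -> T)) f).[y0%:P]).[x0].

(* Cofactors of the Sylvester matrix of F, G (as polynomials in the outer variable t,
   coefficients in Z[s]).  MathComp's Sylvester_mx row k of the F-band encodes t^k F
   and column j encodes t^j; the column encoding t^0 (index 0) is replaced. *)
Definition syl_cof_u (F G : {poly {poly int}}) : {poly {poly int}} :=
  \det (\matrix_(i < ((size G).-1 + (size F).-1)%N, j < ((size G).-1 + (size F).-1)%N)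
          if nat_of_ord j == 0%N then
            (match split i with inl k => 'X^k | inr _ => 0 end)
          else ((Sylvester_mx F G) i j)%:P).

Definition syl_cof_v (F G : {poly {poly int}}) : {poly {poly int}} :=
  \det (\matrix_(i < ((size G).-1 + (size F).-1)%N, j < ((size G).-1 + (size F).-1)%N)
          if nat_of_ord j == 0%N then
            (match split i with inl _ => 0 | inr k => 'X^k end)
          else ((Sylvester_mx F G) i j)%:P).

Definition Ry (f g : {poly {poly int}}) : {poly int} := resultant f g.
Definition Rx (f g : {poly {poly int}}) : {poly int} := resultant (swapXY f) (swapXY g).

(* Cofactors, all written in the layout of f (outer y, inner x):
   R^(y) = u^(y) f + v^(y) g  and  R^(x) = u^(x) f + v^(x) g. *)
Definition uy (f g : {poly {poly int}}) := syl_cof_u f g.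
Definition vy (f g : {poly {poly int}}) := syl_cof_v f g.
Definition ux (f g : {poly {poly int}}) := swapXY (syl_cof_u (swapXY f) (swapXY g)).
Definition vx (f g : {poly {poly int}}) := swapXY (syl_cof_v (swapXY f) (swapXY g)).

Definition divides2 (h f : {poly {poly int}}) := exists k, f = h * k.
Definition is_const2 (h : {poly {poly int}}) := exists c : int, h = (c%:P)%:P.
Definition no_common_factor2 (f g : {poly {poly int}}) :=
  forall h, divides2 h f -> divides2 h g -> is_const2 h.

Definition sqfree_int (p : {poly int}) :=
  p != 0 /\ forall h k : {poly int}, p = h * h * k -> (size h <= 1)%N.
Definition coprime_int (p q : {poly int}) :=
  forall h k1 k2 : {poly int}, p = h * k1 -> q = h * k2 -> (size h <= 1)%N.

Definition sqfree_factorization (P : {poly int}) (r : nat -> {poly int}) :=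
  [/\ P = \prod_(1 <= i < (size P).-1.+1) r i ^+ i,
      forall i, (1 <= i <= (size P).-1)%N -> sqfree_int (r i) &
      forall i j, (1 <= i <= (size P).-1)%N -> (1 <= j <= (size P).-1)%N ->
                  i != j -> coprime_int (r i) (r j)].

(* The predicate T^p_K(m, r). The sum over k >= 1 is finite (p^(k) = 0 for k >= size p);
   p^`N(k) is the k-th derivative divided by k!. *)
Definition Tpred (R : realType) (p : {poly int}) (K m r : R) : Prop :=
  let q := map_poly (intr : int -> R) p in
  0 < `|q.[m]| - K * \sum_(1 <= k < size p) `|(q^`N(k)).[m]| * r ^+ k.

Definition admissible_interval (R : realType) (P : {poly int}) (r : nat -> {poly int})
    (i0 : nat) (alpha a b : R) : Prop :=
  let m := (a + b) / 2 in
  let rad := (b - a) / 2 in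
  [/\ (1 <= i0 <= (size P).-1)%N,
      (map_poly (intr : int -> R) (r i0)).[alpha] = 0,
      a < alpha < b,
      Tpred (r i0)^`() (3 / 2) m (8 * rad) &
      forall i, (1 <= i <= (size P).-1)%N -> i != i0 -> Tpred (r i) 1 m (8 * rad)].

Definition Lbound (R : realType) (P : {poly int}) (i0 : nat) (a b : R) : R :=
  let m := (a + b) / 2 in
  let rad := (b - a) / 2 in
  `|(map_poly (intr : int -> R) P).[m - 2 * rad]| / 2 ^+ (i0 + (size P).-1).

Definition in_disc (R : realType) (c rho : R) (z : R[i]) :=
  `|z - c%:C| < rho%:C.
Definition in_cdisc (R : realType) (c rho : R) (z : R[i]) :=
  `|z - c%:C| <= rho%:C.

(* Main.v *)
Require Import Defs.
From HB Require Import structures.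
From mathcomp Require Import all_boot all_order all_algebra.
From mathcomp Require Import boolp classical_sets reals topology normedtype.
From mathcomp Require Import derive realfun.
From mathcomp.real_closed Require Import complex.
From mathcomp Require Import ring lra.
Set Implicit Arguments.
Unset Strict Implicit.
Unset Printing Implicit Defensive.
Import Order.TTheory GRing.Theory Num.Theory numFieldNormedType.Exports.
Import Normc.
Local Open Scope ring_scope.
Local Open Scope complex_scope.

(* The test predicates force every root of R^(y) other than alpha to lie at
   distance more than 8 r_I from m_I, so comparing |R^(y)| factor by factor at a
   point of the circle of radius 2 r_I with its value at m_I - 2 r_I gives
   |R^(y)| >= L(alpha) on that circle. Hence, by R^(y) = u f + v g, on the part of
   the boundary of the polydisc lying over that circle U |f| + V |g| >= L(alpha);
   likewise with L(beta) on the other part. So the systems f = t f(x0,y0),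
   g = t g(x0,y0) with 0 <= t <= 1 have no solution on the boundary; for t = 1
   there is one inside, namely (x0,y0), and it is followed down to t = 0.
   This could fail if a fibre were a curve, so f and g are first replaced by
   f + eps x^N and g + eps y^N with N larger than both degrees: then all fibres
   are finite and bounded, and by compactness it is enough to find zeros for
   arbitrarily small eps. Solutions persist under small changes of t because, for
   a slope s such that x - s y separates the given solution from the others in its
   fibre, the values of x - s y on the fibre are the roots of a resultant
   depending polynomially on t. Finally a common zero (z1,z2) in the polydisc is
   (alpha,beta), since alpha and beta are the only roots of the resultants in the
   two discs. *)

(** * The modulus on R[i] *)

Section NormcTheory.
Variable R : realType.
Implicit Types (x y z : R[i]).

Lemma normC_normc z : `|z| = (normc z)%:C.
Proof. by case: z. Qed.

Lemma normc_ge0 z : 0 <= normc z.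
Proof. by case: z => a b; exact: sqrtr_ge0. Qed.

Lemma normc_eq0 z : (normc z == 0) = (z == 0).
Proof. by apply/eqP/eqP => [/eq0_normc|->] //; exact: normc0. Qed.

Lemma normc_real (a : R) : normc a%:C = `|a|.
Proof. by rewrite /normc /= expr0n addr0 sqrtr_sqr. Qed.

Lemma le_normcD x y : normc (x + y) <= normc x + normc y.
Proof. by rewrite -lecR rmorphD /= -!normC_normc ler_normD. Qed.

Lemma normcN x : normc (- x) = normc x.
Proof. by apply: complexI; rewrite -!normC_normc normrN. Qed.

Lemma normcBC x y : normc (x - y) = normc (y - x).
Proof. by rewrite -normcN opprB. Qed.

Lemma le_normcB_dist x y z : normc (x - z) <= normc (x - y) + normc (y - z).
Proof. by rewrite -[x - z](subrKA y) le_normcD. Qed.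

Lemma lerB_normcD x y : normc x - normc y <= normc (x + y).
Proof.
have := le_normcD (x + y) (- y); rewrite addrK normcN; lra.
Qed.

Lemma normcX x n : normc (x ^+ n) = normc x ^+ n.
Proof.
by elim: n => [|n IHn]; [exact: normc1 | rewrite !exprS normcM IHn].
Qed.

Lemma normc_prod I (s : seq I) (P : pred I) (F : I -> R[i]) :
  normc (\prod_(i <- s | P i) F i) = \prod_(i <- s | P i) normc (F i).
Proof. exact: (big_morph _ (@normcM R) (@normc1 R)). Qed.

Lemma le_normc_sum I (s : seq I) (P : pred I) (F : I -> R[i]) :
  normc (\sum_(i <- s | P i) F i) <= \sum_(i <- s | P i) normc (F i).
Proof.
elim/big_rec2: _ => [|i b a _ le_ab]; first by rewrite (@normc0 R).
by rewrite (le_trans (le_normcD _ _)) // lerD2l.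
Qed.

Lemma normcMn x n : normc (x *+ n) = normc x *+ n.
Proof. by apply: complexI; rewrite -normC_normc normrMn rmorphMn normC_normc. Qed.

End NormcTheory.

(** * Root exclusion by the test predicate *)

Lemma size_prod_pred (T : idomainType) (I : Type) (s : seq I) (F : I -> {poly T}) :
  \prod_(i <- s) F i != 0 ->
  (size (\prod_(i <- s) F i)).-1 = (\sum_(i <- s) (size (F i)).-1)%N.
Proof.
elim: s => [|i s IHs]; first by rewrite !big_nil size_poly1.
rewrite !big_cons mulf_eq0 negb_or => /andP[F0 s0]; rewrite size_mul //.
rewrite -(IHs s0); move: F0 s0; rewrite -!size_poly_gt0.
set m := size (F i); set n := size _; case: m n => [|k] [|l] //= _ _.
by rewrite addnS.
Qed.

Section TestPredicate.
Variable R : realType.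
Local Notation C := R[i].
Implicit Types (p q : {poly C}) (m r : R).

(** The sum in [Tpred], taken over complex coefficients so that it controls [p] on complex discs. *)
Definition taylor_tail p (c : C) (r : R) : R :=
  \sum_(1 <= k < size p) normc (p^`N(k)).[c] * r ^+ k.

Lemma taylor_tailE p c r n : (size p <= n)%N ->
  taylor_tail p c r = \sum_(1 <= k < n) normc (p^`N(k)).[c] * r ^+ k.
Proof.
move=> le_pn; have [sz0|sz0] := posnP (size p).
  rewrite /taylor_tail sz0 big_geq // big_nat big1 // => k _.
  by rewrite nderivn_poly0 ?sz0 // horner0 normc0 mul0r.
rewrite (big_cat_nat (n := size p)) //= -[LHS]addr0; congr (_ + _).
rewrite big_nat big1 // => k /andP[le_pk _].
by rewrite nderivn_poly0 // horner0 normc0 mul0r.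
Qed.

Lemma taylor_tail_ge0 p c r : 0 <= r -> 0 <= taylor_tail p c r.
Proof.
by move=> r0; apply: sumr_ge0 => k _; rewrite mulr_ge0 ?normc_ge0 ?exprn_ge0.
Qed.

(** In the Taylor expansion at [c], the terms of positive degree add up to at most the tail. *)
Lemma normc_horner_ge p c z r : normc (z - c) <= r ->
  normc p.[c] - taylor_tail p c r <= normc p.[z].
Proof.
move=> le_zr; have r0 : 0 <= r := le_trans (normc_ge0 _) le_zr.
have [->|p0] := eqVneq p 0.
  by rewrite !horner0 lerBlDr lerDl taylor_tail_ge0.
have -> : p.[z] = p.[c] + \sum_(1 <= k < size p) (p^`N(k)).[c] * (z - c) ^+ k.
  rewrite -{1}(subrK c z) addrC nderiv_taylor; last exact: mulrC.
  rewrite -(big_mkord xpredT (fun i => (p^`N(i)).[c] * (z - c) ^+ i)).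
  by rewrite big_ltn ?size_poly_gt0 // nderivn0 expr0 mulr1.
apply: le_trans (lerB_normcD _ _); rewrite lerD2l lerN2.
apply: le_trans (le_normc_sum _ _ _) _; apply: ler_sum => k _.
by rewrite normcM normcX ler_wpM2l ?normc_ge0 // lerXn2r ?nnegrE ?normc_ge0.
Qed.

(** Expand both values at [c] and factor [A - B] out of each difference of powers. The quotient has
    leading term p'(c); the k-th power leaves k products of modulus at most r^(k-1), and k times the
    k-th Taylor coefficient of p is the (k-1)-th one of p'. So the rest is bounded by the tail of
    p'. *)
Lemma normc_slope_ge p c r (A B : C) : normc (A - c) <= r -> normc (B - c) <= r ->
  normc (A - B) * (normc (p^`()).[c] - taylor_tail p^`() c r)
    <= normc (p.[A] - p.[B]).
Proof.
move=> le_Ar le_Br; have r0 : 0 <= r := le_trans (normc_ge0 _) le_Ar.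
set a := A - c in le_Ar *; set b := B - c in le_Br *.
have -> : p.[A] - p.[B] = (A - B) * \sum_(k < size p)
    (p^`N(k)).[c] * \sum_(i < k) a ^+ (k.-1 - i) * b ^+ i.
  have tay z : p.[z] = \sum_(k < size p) (p^`N(k)).[c] * (z - c) ^+ k.
    by have := nderiv_taylor p (mulrC c (z - c)); rewrite addrC subrK.
  rewrite !tay.
  rewrite -sumrB mulr_sumr; apply: eq_bigr => k _.
  by rewrite -mulrBr subrXX mulrCA /a /b opprB addrA subrK.
rewrite normcM ler_wpM2l ?normc_ge0 //.
have [->|p0] := eqVneq p 0.
  by rewrite deriv0 horner0 normc0 sub0r (le_trans _ (normc_ge0 _)) //
    oppr_le0 taylor_tail_ge0.
have dE k : (p^`()^`N(k)).[c] = (p^`N(k.+1)).[c] *+ k.+1.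
  rewrite -hornerMn; congr (_.[c]); apply/polyP => i.
  rewrite coefMn !coef_nderivn coef_deriv addSn -!mulrnA; congr (_ *+ _).
  by rewrite mul_bin_diag mulnC.
case: (posnP (size p).-1) => [sz1 | sz_gt1].
  have /size1_polyC -> : (size p <= 1)%N by rewrite -subn_eq0 subn1 sz1.
  by rewrite derivC horner0 normc0 sub0r (le_trans _ (normc_ge0 _)) //
    oppr_le0 taylor_tail_ge0.
rewrite (taylor_tailE _ _ (n := (size p).-1)); last first.
  by rewrite -ltnS prednK ?lt_size_deriv ?size_poly_gt0.
rewrite -(big_mkord xpredT (fun k => (p^`N(k)).[c] *
  \sum_(i < k) a ^+ (k.-1 - i) * b ^+ i)).
rewrite -{2}(prednK (_ : 0 < size p)%N) ?size_poly_gt0 //.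
rewrite big_nat_recl // big_ord0 mulr0 add0r big_ltn //.
rewrite big_ord1 !expr0 !mulr1 nderivn1.
apply: le_trans (lerB_normcD _ _); rewrite lerD2l lerN2.
apply: le_trans (le_normc_sum _ _ _) _; apply: ler_sum => k _.
rewrite normcM dE normcMn mulrnAl -mulrnAr ler_wpM2l ?normc_ge0 //.
apply: le_trans (le_normc_sum _ _ _) _.
rewrite -[X in _ *+ X]card_ord -sumr_const; apply: ler_sum => i _.
have le_ik : (i <= k)%N by rewrite -ltnS.
rewrite normcM !normcX -[X in _ <= _ ^+ X](subnK le_ik) exprD.
by rewrite ler_pM ?exprn_ge0 ?normc_ge0 // lerXn2r ?nnegrE ?normc_ge0.
Qed.

End TestPredicate.

Section RootExclusion.
Variable R : realType.
Local Notation C := R[i].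
Implicit Types (m r : R).

Definition intC (p : {poly int}) : {poly C} := map_poly intr p.
Definition intR (p : {poly int}) : {poly R} := map_poly intr p.

Lemma intCE (p : {poly int}) : intC p = map_poly (real_complex R) (intR p).
Proof.
by rewrite /intC /intR -map_poly_comp; apply: eq_map_poly => k /=; rewrite rmorph_int.
Qed.

Lemma intC_horner_real (p : {poly int}) (x : R) :
  (intC p).[x%:C] = ((intR p).[x])%:C.
Proof. by rewrite intCE (horner_map (real_complex R)). Qed.

Lemma TpredC (p : {poly int}) (K m r : R) : Tpred p K m r ->
  0 < normc (intC p).[m%:C] - K * taylor_tail (intC p) m%:C r.
Proof.
rewrite /Tpred; congr (_ < _ - _ * _) => //.
  by rewrite intC_horner_real normc_real.
rewrite /taylor_tail size_map_inj_poly //; last exact: intr_inj.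
apply: eq_bigr => k _; congr (_ * _).
by rewrite intCE [in RHS]nderivn_map (horner_map (real_complex R)) normc_real.
Qed.

Lemma Tpred1_neq0 (p : {poly int}) m r z : Tpred p 1 m r ->
  normc (z - m%:C) <= r -> (intC p).[z] != 0.
Proof.
move=> /TpredC; rewrite mul1r => T1 /(normc_horner_ge (intC p)) le_pz.
by rewrite -normc_eq0 gt_eqF // (lt_le_trans T1).
Qed.

Lemma Tpred_weaken (p : {poly int}) (K K' m r : R) :
  0 <= r -> K' <= K -> Tpred p K m r -> Tpred p K' m r.
Proof.
move=> r0 leK; rewrite /Tpred => /lt_le_trans; apply; rewrite lerD2l lerN2 ler_wpM2r //.
by apply: sumr_ge0 => k _; rewrite mulr_ge0 ?exprn_ge0.
Qed.

(** The test makes the lower bound on the slope of chords positive, so [p] is injective on the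
    disc. *)
Lemma Tpred_deriv_inj (p : {poly int}) (m r : R) (A B : C) :
  Tpred p^`() 1 m r -> normc (A - m%:C) <= r -> normc (B - m%:C) <= r ->
  (intC p).[A] = (intC p).[B] -> A = B.
Proof.
move=> /TpredC; rewrite mul1r /intC -deriv_map => T1 le_A le_B eq_AB.
have := normc_slope_ge (intC p) le_A le_B.
rewrite eq_AB subrr normc0 pmulr_lle0 // => nAB.
by apply/eqP; rewrite -subr_eq0 -normc_eq0 eq_le nAB normc_ge0.
Qed.

(** Split [p] into linear factors over the complex numbers: the leading coefficient is common to
    both sides and each root costs one factor [K]. *)
Lemma normc_horner_ratio (p : {poly C}) (u v : C) (K : R) : 0 <= K ->
  (forall z, root p z -> normc (u - z) <= K * normc (v - z)) ->
  normc p.[u] <= K ^+ (size p).-1 * normc p.[v].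
Proof.
move=> K0 ratio; have [s ps] := closed_field_poly_normal p.
have [->|p0] := eqVneq p 0; first by rewrite !horner0 normc0 mulr0.
have lc0 : lead_coef p != 0 by rewrite lead_coef_eq0.
have rts z : z \in s -> root p z.
  by rewrite ps rootZ // root_prod_XsubC.
rewrite {1 3}ps !hornerZ !normcM mulrCA ler_wpM2l ?normc_ge0 //.
have -> : (size p).-1 = size s by rewrite ps size_scale // size_prod_XsubC.
elim: s rts {ps} => [|z s IHs] rts; first by rewrite !big_nil expr0 mul1r !hornerC.
rewrite !big_cons !hornerM !normcM exprS mulrACA !hornerXsubC.
rewrite ler_pM ?normc_ge0 ?ratio ?rts ?mem_head //.
by apply: IHs => y ys; rewrite rts // in_cons ys orbT.
Qed.

(** The points m - 2r and z are at most 4r apart, while xi is more than 6r away from z, so the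
    detour through z at most doubles the distance. *)
Lemma disc_ratio (m r : R) (z xi : C) : 0 < r ->
  normc (z - m%:C) <= 2 * r -> 8 * r < normc (xi - m%:C) ->
  normc ((m - 2 * r)%:C - xi) <= 2 * normc (z - xi).
Proof.
move=> r0 le_z lt_xi.
have := le_normcB_dist xi z m%:C; rewrite (normcBC xi z).
have := le_normcB_dist (m - 2 * r)%:C z xi.
have := le_normcB_dist (m - 2 * r)%:C m%:C z; rewrite (normcBC m%:C z).
have -> : normc ((m - 2 * r)%:C - m%:C) = 2 * r.
  by rewrite -rmorphB normc_real addrAC subrr add0r normrN ger0_norm //; lra.
by move=> *; lra.
Qed.

Lemma Tpred1_ratio (p : {poly int}) m r z : 0 < r -> Tpred p 1 m (8 * r) ->
  normc (z - m%:C) <= 2 * r ->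
  normc (intC p).[(m - 2 * r)%:C] <= 2 ^+ (size p).-1 * normc (intC p).[z].
Proof.
move=> r0 T1 le_z.
have -> : size p = size (intC p) by rewrite size_map_inj_poly //; exact: intr_inj.
apply: normc_horner_ratio => // xi /eqP px0; apply: disc_ratio => //.
rewrite ltNge; apply: contra_eqN px0 => le_xi.
exact: (Tpred1_neq0 T1).
Qed.

(** The root [x] is simple and alone in the disc of radius 8r. The other roots cost a factor 2 each,
    as for a polynomial without roots there; the factor X - x costs 4, hence one more power of 2
    than the degree. *)
Lemma Tpred_deriv_ratio (p : {poly int}) m r (x : R) (z : C) :
  0 < r -> Tpred p^`() 1 m (8 * r) -> (intR p).[x] = 0 -> `|x - m| <= r ->
  normc (z - m%:C) = 2 * r ->
  normc (intC p).[(m - 2 * r)%:C] <= 2 ^+ (size p).-1.+1 * normc (intC p).[z].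
Proof.
move=> r0 T1 px0 le_x eq_z.
have le_xC : normc (x%:C - m%:C) <= 8 * r.
  by rewrite -rmorphB normc_real (le_trans le_x) //; lra.
have px0C : (intC p).[x%:C] = 0 by rewrite intC_horner_real px0.
have [q pq] : exists q, intC p = q * ('X - x%:C%:P).
  by apply/factor_theorem/eqP.
have szp : size p = size (intC p) by rewrite size_map_inj_poly //; exact: intr_inj.
have p0 : intC p != 0.
  apply: contraTneq T1 => p0; have {p0} -> : p = 0.
    by apply/eqP; rewrite -size_poly_eq0 szp p0 size_poly0.
  by rewrite /Tpred deriv0 /= rmorph0 horner0 normr0 size_poly0 big_geq // mulr0 subrr ltxx.
have q0 : q != 0 by apply: contra_neq p0 => q0; rewrite pq q0 mul0r.
have -> : (size p).-1.+1 = ((size q).-1 + 2)%N.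
  rewrite szp pq size_Mmonic ?monicXsubC // size_XsubC !addn2 /= prednK //.
  by rewrite size_poly_gt0.
rewrite exprD pq !hornerM !normcM mulrACA.
apply: ler_pM; rewrite ?normc_ge0 //.
  apply: normc_horner_ratio => // xi /eqP qxi0; apply: disc_ratio => //.
    by rewrite eq_z.
  rewrite ltNge; apply/negP => le_xi.
  (* A root of the cofactor [q] in the disc is [x] by injectivity; then [x] is a double root of [p],
     but the test forbids p'(x) = 0. *)
  have pxi0 : (intC p).[xi] = 0 by rewrite pq hornerM qxi0 mul0r.
  have xiE : xi = x%:C by apply: (Tpred_deriv_inj T1); rewrite ?px0C.
  have := Tpred1_neq0 T1 le_xC; rewrite /intC -deriv_map -/(intC p) pq derivM.
  by rewrite hornerD !hornerM -xiE qxi0 hornerXsubC subrr mulr0 mul0r addr0 eqxx.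
(* Here |m - 2r - x| <= 3r and |z - x| >= 2r - r = r, so the ratio is at most 3, below 2^2. *)
rewrite !hornerXsubC.
have := le_normcB_dist z x%:C m%:C.
have := le_normcB_dist (m - 2 * r)%:C m%:C x%:C.
rewrite eq_z -!rmorphB !normc_real (_ : m - 2 * r - m = - (2 * r)); last lra.
rewrite normrN (distrC m x) (ger0_norm (_ : 0 <= 2 * r)); last lra.
by lra.
Qed.

End RootExclusion.

(** * Roots and lower bound of the resultant on an admissible disc *)

Section Admissible.
Variables (R : realType) (P : {poly int}) (r : nat -> {poly int}) (i0 : nat).
Variables (alpha a b : R).
Hypothesis fact : P = \prod_(1 <= i < (size P).-1.+1) r i ^+ i.
Hypothesis adm : admissible_interval P r i0 alpha a b.
Let m := (a + b) / 2.
Let rad := (b - a) / 2.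

Lemma admissible_rad_gt0 : 0 < rad.
Proof. by case: adm => _ _ /andP[]; rewrite /rad => *; lra. Qed.

Let alpha_m : `|alpha - m| <= rad.
Proof. by case: adm => _ _ /andP[l1 l2] _ _; rewrite ler_norml /m /rad; lra. Qed.

Let T1 : Tpred (r i0)^`() 1 m (8 * rad).
Proof.
case: adm => _ _ _ T _; apply: Tpred_weaken T; last by lra.
by have := admissible_rad_gt0; rewrite /rad; lra.
Qed.

Let P0 : P != 0.
Proof.
by case: adm => /andP[l1 l2] _ _ _ _; rewrite -size_poly_gt0;
  move: (leq_trans l1 l2); case: (size P).
Qed.

Let intC_fact : intC R P = \prod_(1 <= i < (size P).-1.+1) intC R (r i) ^+ i.
Proof. by rewrite {1}fact /intC rmorph_prod; apply: eq_bigr => i _; rewrite rmorphXn. Qed.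

(** A root of [P] is a root of some [r k]. The tests exclude every k other than [i0], and [r i0] is
    injective on the disc. *)
Lemma admissible_root_uniq (z : R[i]) : normc (z - m%:C) <= 2 * rad ->
  (intC R P).[z] = 0 -> z = alpha%:C.
Proof.
have rad0 := admissible_rad_gt0.
case: adm => i0P ra0 _ _ Ti le_z.
have {}le_z : normc (z - m%:C) <= 8 * rad by apply: le_trans le_z _; lra.
rewrite intC_fact horner_prod => /eqP; rewrite prodf_seq_eq0 => /hasP[k].
rewrite mem_index_iota ltnS horner_exp expf_eq0 => kP /= /andP[_ /eqP rkz].
have ki0 : k = i0.
  apply/eqP; apply: contra_eqT rkz => nk; exact: (Tpred1_neq0 (Ti k kP nk)).
apply: (Tpred_deriv_inj T1) => //.
  by rewrite -rmorphB normc_real (le_trans alpha_m) //; lra.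
by rewrite -ki0 rkz ki0 intC_horner_real ra0.
Qed.

Lemma admissible_Lbound (z : R[i]) : normc (z - m%:C) = 2 * rad ->
  Lbound P i0 a b <= normc (intC R P).[z].
Proof.
have rad0 := admissible_rad_gt0.
case: (adm) => i0P ra0 _ _ Ti eq_z.
rewrite /Lbound -/m -/rad ler_pdivrMr ?exprn_gt0 // -normc_real -intC_horner_real.
rewrite intC_fact !horner_prod !normc_prod.
(* [e i] is the power of 2 lost on [r i]; weighted by the multiplicities i, these sum to deg P plus
   [i0], the exponent in [Lbound]. *)
pose e i := ((size (r i)).-1 + (i == i0))%N.
have -> : (i0 + (size P).-1)%N = (\sum_(1 <= i < (size P).-1.+1) e i * i)%N.
  have i0in : i0 \in index_iota 1 (size P).-1.+1 by rewrite mem_index_iota ltnS.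
  under eq_bigr => i _ do rewrite /e mulnDl.
  rewrite big_split addnC /=; congr (_ + _)%N.
    rewrite [in LHS]fact size_prod_pred -?fact //; apply: eq_bigr => i _.
    by rewrite size_exp.
  rewrite (bigD1_seq i0) ?iota_uniq //= eqxx mul1n big1 ?addn0 // => i.
  by move=> /negPf ->.
rewrite [leRHS]mulrC expr_sum -big_split /= big_seq [leRHS]big_seq; apply: ler_prod => i.
rewrite mem_index_iota ltnS => iP; rewrite normc_ge0 /=.
rewrite !horner_exp !normcX exprM -exprMn lerXn2r ?nnegrE ?normc_ge0 //.
  by rewrite mulr_ge0 ?exprn_ge0 ?normc_ge0.
have [ii0|ni] := eqVneq i i0.
  rewrite /e ii0 eqxx addn1; exact: Tpred_deriv_ratio rad0 T1 ra0 alpha_m eq_z.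
by rewrite /e (negPf ni) addn0; apply: Tpred1_ratio (Ti i iP ni) _; rewrite ?eq_z.
Qed.

End Admissible.

(** * Compactness in C^2 *)

Section PolydiscCompactness.
Variable R : realType.
Local Notation C := R[i].
Local Notation T4 := ((R * R) * (R * R))%type.

(** A function on C^2 is read on R^4, where continuity and compactness are those of real
    products. *)
Definition real4 (h : C -> C -> R) (v : T4) : R :=
  h (v.1.1 +i* v.1.2) (v.2.1 +i* v.2.2).

Definition cont2R (h : C -> C -> R) := continuous (real4 h).

Definition cont2C (F : C -> C -> C) :=
  cont2R (fun x y => complex.Re (F x y)) /\ cont2R (fun x y => complex.Im (F x y)).

(** The region is written [0 <= psi] with [psi] continuous, so it is closed; being bounded it is
    compact, and [h] attains its minimum there. *)
Lemma cont2R_pos_bound (h psi : C -> C -> R) (M : R) :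
  cont2R h -> cont2R psi ->
  (forall x y, 0 <= psi x y -> normc x <= M /\ normc y <= M) ->
  (forall x y, 0 <= psi x y -> 0 < h x y) ->
  exists2 kappa, 0 < kappa & forall x y, 0 <= psi x y -> kappa <= h x y.
Proof.
move=> ch cpsi bnd pos.
pose box : set T4 := ((`[-M, M] `*` `[-M, M]) `*` (`[-M, M] `*` `[-M, M]))%classic.
pose A : set T4 := (box `&` real4 psi @^-1` [set u | 0 <= u])%classic.
have cA : compact A.
  apply: compact_closedI.
    by do !apply: compact_setX; exact: segment_compact.
  apply: closed_comp => [v _|]; first exact: cpsi.
  exact: closed_ge.
have le_comp (z : C) : `|complex.Re z| <= normc z /\ `|complex.Im z| <= normc z.
  case: z => u v /=; split; rewrite -sqrtr_sqr ler_wsqrtr ?lerDl ?lerDr ?sqr_ge0 //.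
have AP x y : 0 <= psi x y ->
    A ((complex.Re x, complex.Im x), (complex.Re y, complex.Im y)).
  move=> psi0; have [le_x le_y] := bnd _ _ psi0.
  have [x1 x2] := le_comp x; have [y1 y2] := le_comp y.
  split; last by rewrite /preimage /real4 /=; case: (x) (y) psi0 => ? ? [].
  by split; split; rewrite /= in_itv /= -ler_norml;
    by [apply: le_trans le_x | apply: le_trans le_y].
(* On an empty region any positive constant will do. *)
have [[x0 [y0 psi0]]|no] := pselect (exists x y, 0 <= psi x y); last first.
  by exists 1 => // x y psi0; case: no; exists x, y.
have [|v /set_mem Av minv] := compact_EVT_min _ cA (continuous_subspaceT ch).
  by eexists; exact: AP psi0.
exists (real4 h v); first by apply: pos; case: Av.
by move=> x y /AP /mem_set/minv; rewrite /real4 /=; case: x y => ? ? [].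
Qed.

Lemma cont2C_cst (c : C) : cont2C (fun _ _ => c).
Proof. by split=> v; exact: cvg_cst. Qed.

Lemma cont2C_fst : cont2C (fun x _ => x).
Proof.
split=> v; rewrite /real4 /=.
  exact: (continuous_comp (f := fst) (g := fst) cvg_fst cvg_fst).
exact: (continuous_comp (f := fst) (g := snd) cvg_fst cvg_snd).
Qed.

Lemma cont2C_snd : cont2C (fun _ y => y).
Proof.
split=> v; rewrite /real4 /=.
  exact: (continuous_comp (f := snd) (g := fst) cvg_snd cvg_fst).
exact: (continuous_comp (f := snd) (g := snd) cvg_snd cvg_snd).
Qed.

Lemma cont2CD (F G : C -> C -> C) :
  cont2C F -> cont2C G -> cont2C (fun x y => F x y + G x y).
Proof.
move=> [F1 F2] [G1 G2]; split=> v.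
- have -> : real4 (fun x y => complex.Re (F x y + G x y)) =
    (fun v => real4 (fun x y => complex.Re (F x y)) v +
              real4 (fun x y => complex.Re (G x y)) v).
    by apply/funext => w; rewrite /real4 raddfD.
  by apply: cvgD; [exact: F1 | exact: G1].
- have -> : real4 (fun x y => complex.Im (F x y + G x y)) =
    (fun v => real4 (fun x y => complex.Im (F x y)) v +
              real4 (fun x y => complex.Im (G x y)) v).
    by apply/funext => w; rewrite /real4 raddfD.
  by apply: cvgD; [exact: F2 | exact: G2].
Qed.

Lemma cont2CM (F G : C -> C -> C) :
  cont2C F -> cont2C G -> cont2C (fun x y => F x y * G x y).
Proof.
move=> [F1 F2] [G1 G2]; split=> v.
- have -> : real4 (fun x y => complex.Re (F x y * G x y)) =
    (fun v => real4 (fun x y => complex.Re (F x y)) v *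
              real4 (fun x y => complex.Re (G x y)) v -
              real4 (fun x y => complex.Im (F x y)) v *
              real4 (fun x y => complex.Im (G x y)) v).
    by apply/funext => w; rewrite /real4; case: (F _ _) (G _ _) => ? ? [].
  by apply: cvgB; apply: cvgM; [exact: F1 | exact: G1 | exact: F2 | exact: G2].
- have -> : real4 (fun x y => complex.Im (F x y * G x y)) =
    (fun v => real4 (fun x y => complex.Re (F x y)) v *
              real4 (fun x y => complex.Im (G x y)) v +
              real4 (fun x y => complex.Im (F x y)) v *
              real4 (fun x y => complex.Re (G x y)) v).
    by apply/funext => w; rewrite /real4; case: (F _ _) (G _ _) => ? ? [].
  by apply: cvgD; apply: cvgM; [exact: F1 | exact: G2 | exact: F2 | exact: G1].
Qed.

Lemma cont2CX (F : C -> C -> C) n : cont2C F -> cont2C (fun x y => F x y ^+ n).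
Proof.
move=> cF; elim: n => [|n IHn].
  by have -> : (fun x y => F x y ^+ 0) = (fun _ _ => 1); [exact/funext | exact: cont2C_cst].
have -> : (fun x y => F x y ^+ n.+1) = (fun x y => F x y * F x y ^+ n).
  by do 2 apply/funext => ?; rewrite exprS.
exact: cont2CM.
Qed.

Lemma cont2C_horner (P : {poly {poly C}}) : cont2C (fun x y => P.[y%:P].[x]).
Proof.
elim/poly_ind: P => [|P p IHP].
  have -> : (fun x y : C => (0 : {poly {poly C}}).[y%:P].[x]) = (fun _ _ => 0).
    by do 2 apply/funext => ?; rewrite !horner0.
  exact: cont2C_cst.
have -> : (fun x y => (P * 'X + p%:P).[y%:P].[x]) =
    (fun x y => P.[y%:P].[x] * y + p.[x]).
  by do 2 apply/funext => ?; rewrite hornerMXaddC hornerD hornerM hornerC.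
apply: cont2CD; first by apply: cont2CM => //; exact: cont2C_snd.
elim/poly_ind: p => [|p c IHp].
  have -> : (fun x y : C => (0 : {poly C}).[x]) = (fun _ _ => 0).
    by do 2 apply/funext => ?; rewrite !horner0.
  exact: cont2C_cst.
have -> : (fun x y : C => (p * 'X + c%:P).[x]) = (fun x y : C => p.[x] * x + c).
  by do 2 apply/funext => ?; rewrite hornerMXaddC.
apply: cont2CD (cont2C_cst c); apply: cont2CM => //; exact: cont2C_fst.
Qed.

Lemma cont2R_normc (F : C -> C -> C) :
  cont2C F -> cont2R (fun x y => normc (F x y)).
Proof.
move=> [F1 F2] v.
have -> : real4 (fun x y => normc (F x y)) =
    (fun v => Num.sqrt (real4 (fun x y => complex.Re (F x y)) v ^+ 2 +
                        real4 (fun x y => complex.Im (F x y)) v ^+ 2)).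
  by apply/funext => w; rewrite /real4; case: (F _ _).
apply: continuous_comp; last exact: sqrt_continuous.
by apply: cvgD; apply: cvgM; by [exact: F1 | exact: F2].
Qed.

Lemma cont2RD (h k : C -> C -> R) :
  cont2R h -> cont2R k -> cont2R (fun x y => h x y + k x y).
Proof. by move=> hc kc v; apply: cvgD; [exact: hc | exact: kc]. Qed.

Lemma cont2RN (h : C -> C -> R) : cont2R h -> cont2R (fun x y => - h x y).
Proof. by move=> hc v; apply: cvgN; exact: hc. Qed.

Lemma cont2R_cst (u : R) : cont2R (fun _ _ => u).
Proof. by move=> v; exact: cvg_cst. Qed.

Lemma cont2R_min (h k : C -> C -> R) :
  cont2R h -> cont2R k -> cont2R (fun x y => Num.min (h x y) (k x y)).
Proof. by move=> hc kc v; apply: continuous_min; [exact: hc | exact: kc]. Qed.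

Lemma cont2R_max (h k : C -> C -> R) :
  cont2R h -> cont2R k -> cont2R (fun x y => Num.max (h x y) (k x y)).
Proof. by move=> hc kc v; apply: continuous_max; [exact: hc | exact: kc]. Qed.

End PolydiscCompactness.

(** * Persistence of solutions *)

Section RootPerturbation.
Variable R : realType.
Local Notation C := R[i].

Lemma poly_neq0_horner (p : {poly C}) : p != 0 -> exists x, p.[x] != 0.
Proof.
move=> p0; apply: contrapT => no.
pose s := [seq (k%:R : C) | k <- iota 0 (size p)].
have : (size s < size p)%N.
  apply: max_poly_roots => //.
    by apply/allP => x _; apply: contraT => px; case: no; exists x.
  rewrite map_inj_uniq ?iota_uniq // => k l /eqP; rewrite eqr_nat; exact: eqP.
by rewrite size_map size_iota ltnn.
Qed.

Lemma exists_notin_seq (s : seq C) : exists x, x \notin s.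
Proof.
have [|x] := @poly_neq0_horner (\prod_(a <- s) ('X - a%:P)).
  by rewrite monic_neq0 ?monic_prod_XsubC.
by rewrite -[_ == 0]/(root _ x) root_prod_XsubC; exists x.
Qed.

Lemma poly_roots_seq (p : {poly C}) : p != 0 ->
  exists s : seq C, forall x, root p x -> x \in s.
Proof.
move=> p0; have [s ps] := closed_field_poly_normal p; exists s => x.
by rewrite ps rootZ ?lead_coef_eq0 // root_prod_XsubC.
Qed.

Lemma horner_lipschitz (p : {poly C}) (t0 : C) : exists2 L, 0 <= L &
  forall t, normc (t - t0) <= 1 -> normc (p.[t] - p.[t0]) <= L * normc (t - t0).
Proof.
elim/poly_ind: p => [|p c [L L0 IHp]].
  by exists 0 => // t _; rewrite !horner0 subrr normc0 mul0r.
exists (L * (normc t0 + 1) + normc p.[t0]) => [|t tt0].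
  by rewrite addr_ge0 ?mulr_ge0 ?addr_ge0 ?normc_ge0.
have -> : (p * 'X + c%:P).[t] - (p * 'X + c%:P).[t0] =
   (p.[t] - p.[t0]) * t + p.[t0] * (t - t0).
  by rewrite !hornerMXaddC; ring.
rewrite (le_trans (le_normcD _ _)) // !normcM mulrDl lerD2r mulrAC.
rewrite ler_pM ?normc_ge0 ?IHp //.
by have := le_normcB_dist t t0 0; rewrite !subr0; lra.
Qed.

Lemma horner_continuous (p : {poly C}) (t0 : C) (eta : R) : 0 < eta ->
  exists2 delta, 0 < delta &
  forall t, normc (t - t0) < delta -> normc (p.[t] - p.[t0]) < eta.
Proof.
move=> eta0; have [L L0 lip] := horner_lipschitz p t0.
exists (Num.min 1 (eta / (L + 1))) => [|t].
  by rewrite lt_min ltr01 divr_gt0 // ltr_wpDl.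
rewrite lt_min ltr_pdivlMr ?ltr_wpDl // => /andP[t1 tL].
rewrite (le_lt_trans (lip t (ltW t1))) // (le_lt_trans _ tL) //.
by rewrite mulrC ler_wpM2l ?normc_ge0 // lerDl.
Qed.

(** The outer variable of [T] is X and the inner one is the parameter t, which is specialized
    here. *)
Local Notation spec T t := (map_poly (horner_eval t) T).

Lemma horner_spec (T : {poly {poly C}}) (t X : C) : (spec T t).[X] = T.[X%:P].[t].
Proof.
rewrite -[RHS]/(horner_eval t T.[X%:P]) -horner_map; congr (_.[_]).
by rewrite /= /horner_eval hornerC.
Qed.

(** Take [X1] that is not a root at [t0]. If at t all roots were at least [eps] away from [X0], then
    |X1 - z| <= K |X0 - z| for every root z, so the value at [X1] would be at most a power of [K]
    times the value at [X0]. For t near [t0] the former stays away from 0 and the latter is close to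
    0. *)
Lemma root_perturbation (T : {poly {poly C}}) (t0 X0 : C) (eps : R) :
  0 < eps -> spec T t0 != 0 -> (spec T t0).[X0] = 0 ->
  exists2 delta, 0 < delta & forall t, normc (t - t0) < delta ->
    exists2 X, normc (X - X0) < eps & (spec T t).[X] = 0.
Proof.
move=> eps0 /poly_neq0_horner[X1 TX1] TX0.
pose K := 1 + normc (X1 - X0) / eps.
have K1 : 1 <= K by rewrite lerDl divr_ge0 ?normc_ge0 // ltW.
pose eta := normc (spec T t0).[X1] / 2.
have eta0 : 0 < eta by rewrite divr_gt0 // lt_def normc_eq0 TX1 normc_ge0.
have Kn0 : 0 < K ^+ size T by rewrite exprn_gt0 // (lt_le_trans ltr01).
have [d1 d10 near1] := horner_continuous T.[X1%:P] t0 eta0.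
have [d2 d20 near0] := horner_continuous T.[X0%:P] t0 (divr_gt0 eta0 Kn0).
exists (Num.min d1 d2) => [|t]; first by rewrite lt_min d10.
rewrite lt_min => /andP[/near1 td1 /near0 td2]; apply: contrapT => far.
rewrite -!horner_spec TX0 subr0 in td1 td2.
have : normc (spec T t).[X1] <= K ^+ (size (spec T t)).-1 * normc (spec T t).[X0].
  apply: normc_horner_ratio => [|z /eqP Tz]; first exact: le_trans K1.
  have le_z : eps <= normc (X0 - z).
    by rewrite leNgt normcBC; apply/negP => lt_z; case: far; exists z.
  apply: le_trans (le_normcB_dist _ X0 _) _; rewrite /K mulrDl mul1r addrC.
  rewrite lerD2l mulrAC ler_pdivlMr // ler_wpM2l ?normc_ge0 //.
(* The degree may depend on t; since [K] is at least 1, one exponent serves all t. *)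
have le_sz : K ^+ (size (spec T t)).-1 <= K ^+ size T.
  by rewrite ler_weXn2l // (leq_trans (leq_pred _)) // size_poly.
rewrite ltr_pdivlMr // in td2.
have : K ^+ (size (spec T t)).-1 * normc (spec T t).[X0] < eta.
  by apply: le_lt_trans td2; rewrite mulrC ler_wpM2l ?normc_ge0.
have := le_normcB_dist 0 (spec T t).[X1] (spec T t0).[X1].
rewrite !sub0r !normcN; rewrite /eta in td1 *; lra.
Qed.

(** [T] is the resultant in y of F - t c1 and G - t c2. Their leading coefficients in y are nonzero
    constants, so taking the resultant commutes with specializing t and X, and its vanishing means a
    common root y. *)
Lemma elimination_polynomial (F G : {poly {poly C}}) (n : nat) (a b c1 c2 : C) :
  size F = n.+2 -> size G = n.+2 -> lead_coef F = a%:P -> lead_coef G = b%:P ->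
  exists T : {poly {poly C}}, forall t X, (spec T t).[X] = 0 <->
    exists2 y, F.[y%:P].[X] = t * c1 & G.[y%:P].[X] = t * c2.
Proof.
move=> szF szG lcF lcG.
(* Three layers of variables: y outermost, then X, and t innermost. *)
pose lift (P : {poly {poly C}}) := map_poly (map_poly polyC) P.
pose H (P : {poly {poly C}}) c : {poly {poly {poly C}}} :=
  lift P - ((c%:P * 'X)%:P)%:P.
exists (resultant (H F c1) (H G c2)) => t X.
pose e := horner_eval X \o map_poly (horner_eval t).
have injC : injective (map_poly (polyC : C -> {poly C})).
  by apply: map_inj_poly => //; exact: polyC_inj.
have lcH (P : {poly {poly C}}) (c u : C) : size P = n.+2 -> lead_coef P = u%:P ->
    lead_coef (H P c) = (u%:P)%:P.
  move=> szP lcP; have szl : size (lift P) = n.+2.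
    by rewrite size_map_inj_poly // rmorph0.
  (* The subtracted term is constant in y, while [P] has positive degree in y. *)
  rewrite lead_coefDl; last by rewrite size_polyN szl (leq_ltn_trans (size_polyC_leq1 _)).
  rewrite lead_coef_map_inj // ?rmorph0 //.
  by rewrite lcP map_polyC.
have neq0 (P : {poly {poly C}}) (u : C) : size P = n.+2 -> lead_coef P = u%:P :> {poly C} -> u != 0.
  move=> szP lcP; apply/eqP => u0; move/eqP: lcP; rewrite u0 lead_coef_eq0.
  by rewrite -size_poly_eq0 szP.
have eC (u : C) : e (u%:P)%:P = u.
  by rewrite /e /= map_polyC /= /horner_eval !hornerC.
have eH (P : {poly {poly C}}) (c y : C) : (map_poly e (H P c)).[y] = P.[y%:P].[X] - t * c.
  rewrite rmorphB hornerD hornerN; congr (_ - _).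
    rewrite -horner_spec /lift /= -map_poly_comp; congr (_.[y]).
    apply: eq_map_poly => p; rewrite /e /= -map_poly_comp; congr (_.[X]).
    by rewrite map_poly_id // => u _; rewrite /= /horner_eval hornerC.
  rewrite /= map_polyC hornerC /= map_polyC /= /horner_eval hornerC.
  by rewrite hornerM hornerC hornerX mulrC.
have -> : (spec (resultant (H F c1) (H G c2)) t).[X] =
    resultant (map_poly e (H F c1)) (map_poly e (H G c2)).
  by apply: (@map_resultant _ _ (horner_eval X \o map_poly (horner_eval t)));
    rewrite ?(lcH _ _ _ szF lcF) ?(lcH _ _ _ szG lcG) [X in X != _]eC;
    [exact: neq0 szF lcF | exact: neq0 szG lcG].
split=> [/eqP|[y yF yG]].
  rewrite resultant_eq0 => sz_gcd.
  have /closed_rootP[y] : size (gcdp (map_poly e (H F c1)) (map_poly e (H G c2))) != 1.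
    by rewrite gtn_eqF.
  rewrite root_gcd /root !eH !subr_eq0 => /andP[/eqP yF /eqP yG].
  by exists y.
apply/eqP; rewrite resultant_eq0.
have : root (gcdp (map_poly e (H F c1)) (map_poly e (H G c2))) y.
  by rewrite root_gcd /root !eH yF yG !subrr eqxx.
apply: root_size_gt1; rewrite gcdp_eq0 negb_and map_poly_eq0_id0.
  by rewrite -lead_coef_eq0 (lcH _ _ _ szF lcF) !polyC_eq0 (neq0 _ _ szF lcF).
by rewrite (lcH _ _ _ szF lcF) eC (neq0 _ _ szF lcF).
Qed.

End RootPerturbation.

(** * Shearing, and the perturbation by high powers of x and y *)

Section Shear.
Variable R : realType.
Local Notation C := R[i].
Implicit Types (P F G : {poly {poly C}}) (s x y X : C).

Definition shear_var s : {poly {poly C}} := 'X%:P + s%:P%:P * 'X.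

(** Substitution of X + s y for x with y kept. Composing evaluation morphisms makes it a ring
    morphism by construction. *)
Definition shear s : {poly {poly C}} -> {poly {poly C}} :=
  horner_eval 'X \o
  map_poly (horner_eval (shear_var s) \o map_poly (polyC \o (polyC : C -> {poly C}))).

HB.instance Definition _ s := GRing.RMorphism.on (shear s).

Lemma shearX s : shear s 'X = 'X.
Proof. by rewrite /shear /= map_polyX /horner_eval hornerX. Qed.

Lemma shearXC s : shear s 'X%:P = shear_var s.
Proof. by rewrite /shear /= map_polyC /= map_polyX /horner_eval hornerC hornerX. Qed.

Lemma shearC s (c : C) : shear s c%:P%:P = c%:P%:P.
Proof.
by rewrite /shear /= !(map_polyC, horner_evalE, hornerC) /= map_polyC
  /horner_eval !hornerC.
Qed.

Lemma poly2_ind (K : {poly {poly C}} -> Prop) :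
  (forall c : C, K c%:P%:P) ->
  (forall (p : {poly C}) (c : C), K p%:P -> K (p%:P * 'X%:P + c%:P%:P)) ->
  (forall P (p : {poly C}), K P -> K p%:P -> K (P * 'X + p%:P)) ->
  forall P, K P.
Proof.
move=> KC KX KY; have Kp (p : {poly C}) : K p%:P.
  elim/poly_ind: p => [|p c IHp]; first by rewrite -polyC0; exact: KC.
  by rewrite polyCD polyCM; exact: KX.
by elim/poly_ind => [|P p IHP]; [exact: (Kp 0) | exact: KY].
Qed.

Lemma horner_shear s P X y : (shear s P).[y%:P].[X] = P.[y%:P].[X + s * y].
Proof.
elim/poly2_ind: P => [c|p c IHp|P p IHP IHp].
- by rewrite shearC !hornerC.
- rewrite rmorphD rmorphM /= shearXC shearC !(hornerD, hornerM, hornerX, hornerC).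
  by rewrite IHp hornerC.
- rewrite rmorphD rmorphM /= shearX !(hornerD, hornerM, hornerX, hornerC).
  by rewrite IHP IHp !hornerC.
Qed.

(* The two consequences of having total degree less than [n] that the argument
   needs, used in place of the degree itself. *)
Definition total_degree_le n P :=
  (forall s, size (shear s P) <= n)%N /\
  exists2 A : R, 0 <= A & forall rho x y, 1 <= rho -> normc x <= rho -> normc y <= rho ->
    normc P.[y%:P].[x] <= A * rho ^+ n.

Lemma total_degree_leW m n P : (m <= n)%N -> total_degree_le m P -> total_degree_le n P.
Proof.
move=> le_mn [szP [A A0 growth]]; split=> [s|].
  exact: leq_trans le_mn.
exists A => // rho x y rho1 xr yr; apply: le_trans (growth _ _ _ rho1 xr yr) _.
by rewrite ler_wpM2l // ler_weXn2l.
Qed.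

Lemma total_degree_leD n P Q :
  total_degree_le n P -> total_degree_le n Q -> total_degree_le n (P + Q).
Proof.
move=> [szP [A A0 grP]] [szQ [B B0 grQ]]; split=> [s|].
  by rewrite rmorphD (leq_trans (size_polyD _ _)) // geq_max szP szQ.
exists (A + B) => [|rho x y rho1 xr yr]; first exact: addr_ge0.
rewrite !hornerD mulrDl (le_trans (le_normcD _ _)) //.
by rewrite lerD ?grP ?grQ.
Qed.

Lemma total_degree_leC c : total_degree_le 1 c%:P%:P.
Proof.
split=> [s|]; first by rewrite shearC size_polyC_leq1.
exists (normc c) => [|rho x y rho1 _ _]; first exact: normc_ge0.
by rewrite !hornerC expr1 ler_peMr ?normc_ge0.
Qed.

Lemma total_degree_leMX n P :
  total_degree_le n P -> total_degree_le n.+1 (P * 'X).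
Proof.
move=> [szP [A A0 grP]]; split=> [s|].
  rewrite rmorphM /= shearX (leq_trans (size_polyMleq _ _)) //.
  by rewrite size_polyX addn2 /= ltnS.
exists A => // rho x y rho1 xr yr.
by rewrite !hornerM !hornerX hornerC normcM exprSr mulrA ler_pM ?normc_ge0 ?grP.
Qed.

Lemma size_shear_var s : (size (shear_var s) <= 2)%N.
Proof.
rewrite (leq_trans (size_polyD _ _)) // geq_max.
rewrite (leq_trans (size_polyC_leq1 _)) //= (leq_trans (size_polyMleq _ _)) //.
by rewrite size_polyX addn2 /= ltnS size_polyC_leq1.
Qed.

Lemma total_degree_leMXC n P :
  total_degree_le n P -> total_degree_le n.+1 (P * 'X%:P).
Proof.
move=> [szP [A A0 grP]]; split=> [s|].
  rewrite rmorphM /= shearXC (leq_trans (size_polyMleq _ _)) //.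
  by rewrite -subn1 leq_subLR add1n -addn2 leq_add ?size_shear_var.
exists A => // rho x y rho1 xr yr.
by rewrite !hornerM !hornerC hornerX normcM exprSr mulrA ler_pM ?normc_ge0 ?grP.
Qed.

Lemma total_degree_le_exists P : exists n, total_degree_le n P.
Proof.
elim/poly2_ind: P => [c|p c [n tp]|P p [n tP] [m tp]].
- by exists 1%N; exact: total_degree_leC.
- exists n.+1; apply: total_degree_leD; first exact: total_degree_leMXC.
  by apply: total_degree_leW (total_degree_leC c).
- exists (maxn n.+1 m); apply: total_degree_leD.
    by apply: total_degree_leW (total_degree_leMX tP); exact: leq_maxl.
  by apply: total_degree_leW tp; exact: leq_maxr.
Qed.

Lemma lead_shear_var s : s != 0 ->
  size (shear_var s) = 2 /\ lead_coef (shear_var s) = s%:P.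
Proof.
move=> s0; have sX : size (s%:P%:P * 'X : {poly {poly C}}) = 2.
  by rewrite size_Cmul ?polyC_eq0 // size_polyX.
have lt2 : leq (size ('X%:P : {poly {poly C}})).+1 (size (s%:P%:P * 'X)).
  by rewrite sX ltnS size_polyC_leq1.
rewrite /shear_var addrC size_polyDl // sX lead_coefDl //.
by rewrite lead_coef_Mmonic ?monicX // lead_coefC.
Qed.

(** After the shear the added powers have degree n+1 in y, with constant leading coefficients eps
    s^(n+1) and eps, and dominate the sheared [F] and [G]; so the elimination polynomial exists. *)
Lemma elimination_perturbed F G n (eps c1 c2 s : C) : eps != 0 -> s != 0 ->
  total_degree_le n F -> total_degree_le n G ->
  exists T : {poly {poly C}}, forall t X,
    (map_poly (horner_eval t) T).[X] = 0 <->
    exists2 y, F.[y%:P].[X + s * y] + eps * (X + s * y) ^+ n.+1 = t * c1 &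
               G.[y%:P].[X + s * y] + eps * y ^+ n.+1 = t * c2.
Proof.
move=> eps0 s0 [szF _] [szG _].
pose F' := F + eps%:P%:P * 'X%:P ^+ n.+1; pose G' := G + eps%:P%:P * 'X ^+ n.+1.
have [szW lcW] := lead_shear_var s0.
have W0 : shear_var s != 0 by rewrite -size_poly_eq0 szW.
have epsP0 : eps%:P != 0 :> {poly C} by rewrite polyC_eq0.
have lead (P Q : {poly {poly C}}) u : (size (shear s P) <= n)%N ->
    size (shear s Q) = n.+2 -> lead_coef (shear s Q) = u%:P ->
    size (shear s (P + eps%:P%:P * Q)) = n.+2 /\
    lead_coef (shear s (P + eps%:P%:P * Q)) = (eps * u)%:P.
  move=> szP szQ lcQ; rewrite rmorphD rmorphM /= shearC.
  have szeQ : size (eps%:P%:P * shear s Q) = n.+2 by rewrite size_Cmul.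
  rewrite addrC size_polyDl ?lead_coefDl szeQ ?ltnS ?(leq_trans szP) //.
  by rewrite mul_polyC lead_coefZ lcQ polyCM.
have [szF' lcF'] : size (shear s F') = n.+2 /\ lead_coef (shear s F') = (eps * s ^+ n.+1)%:P.
  apply: lead => //; rewrite rmorphXn /= shearXC.
    by have := size_exp (shear_var s) n.+1; rewrite szW mul1n; case: (size _) => [|k] //= ->.
  by rewrite lead_coef_exp lcW rmorphXn.
have [szG' lcG'] : size (shear s G') = n.+2 /\ lead_coef (shear s G') = (eps * 1)%:P.
  apply: lead => //; rewrite rmorphXn /= shearX ?size_polyXn //.
  by rewrite lead_coefXn.
have [T TP] := elimination_polynomial c1 c2 szF' szG' lcF' lcG'.
exists T => t X; rewrite TP; split=> -[y]; rewrite ?horner_shear /F' /G';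
  rewrite ?(hornerD, hornerM, hornerC, horner_exp, hornerX) => yF yG;
  by exists y; rewrite ?horner_shear ?(hornerD, hornerM, hornerC, horner_exp, hornerX).
Qed.

(** Let rho be the maximum of 1, |x| and |y|. If rho is not 1, the equation whose added power
    involves the larger variable gives eps rho^(n+1) <= D rho^n. *)
Lemma perturbed_bounded F G n (eps : R) (c1 c2 : C) : 0 < eps ->
  total_degree_le n F -> total_degree_le n G ->
  exists M : R, forall t x y, normc t <= 2 ->
    F.[y%:P].[x] + eps%:C * x ^+ n.+1 = t * c1 ->
    G.[y%:P].[x] + eps%:C * y ^+ n.+1 = t * c2 -> normc x <= M /\ normc y <= M.
Proof.
move=> eps0 [_ [A A0 grF]] [_ [B B0 grG]].
(* [A] and [B] come from the growth of [F] and [G], the factor 2 from |t| <= 2. *)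
pose D := A + B + 2 * (normc c1 + normc c2).
have D0 : 0 <= D by rewrite !addr_ge0 ?mulr_ge0 ?addr_ge0 ?normc_ge0.
exists (1 + D / eps) => t x y t2 eF eG.
have bound (P : {poly {poly C}}) (E : R) (z c : C) rho : 0 <= E -> 1 <= rho ->
    normc P.[y%:P].[x] <= E * rho ^+ n -> P.[y%:P].[x] + eps%:C * z ^+ n.+1 = t * c ->
    eps * normc z ^+ n.+1 <= (E + 2 * normc c) * rho ^+ n.
  move=> E0 rho1 le_P eP.
  have -> : eps * normc z ^+ n.+1 = normc (t * c - P.[y%:P].[x]).
    by rewrite -eP addrAC subrr add0r normcM normcX normc_real ger0_norm // ltW.
  rewrite (le_trans (le_normcD _ _)) // normcN normcM mulrDl addrC lerD //.
  rewrite -[leLHS]mulr1 ler_pM ?mulr_ge0 ?normc_ge0 ?exprn_ege1 //.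
  by rewrite ler_wpM2r ?normc_ge0.
pose rho := Num.max 1 (Num.max (normc x) (normc y)).
have rho1 : 1 <= rho by rewrite le_max lexx.
have xr : normc x <= rho by rewrite !le_max lexx orbT.
have yr : normc y <= rho by rewrite !le_max lexx !orbT.
suff le_rho : rho <= 1 + D / eps by split; apply: le_trans le_rho.
have rn0 : 0 < rho ^+ n by rewrite exprn_gt0 // (lt_le_trans ltr01).
have step z c E : 0 <= E -> E + 2 * normc c <= D -> rho = normc z ->
    eps * normc z ^+ n.+1 <= (E + 2 * normc c) * rho ^+ n -> rho <= 1 + D / eps.
  move=> E0 leD ez; rewrite -ez exprS mulrA ler_pM2r // => le_r.
  apply: (@le_trans _ _ (D / eps)); last by rewrite lerDr.
  by rewrite ler_pdivlMr // mulrC (le_trans le_r).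
have := normc_ge0 c1; have := normc_ge0 c2 => n2 n1.
have [rho_eq1|] : rho = 1 \/ (rho = normc x \/ rho = normc y).
  rewrite /rho /Num.max; case: ifP => _; last by left.
  by right; case: ifP => _; [right|left].
  by rewrite rho_eq1 lerDl divr_ge0 // ltW.
case=> er.
  apply: (step x c1 A) => //; first by rewrite /D; lra.
  exact: bound (grF _ _ _ rho1 xr yr) eF.
apply: (step y c2 B) => //; first by rewrite /D; lra.
exact: bound (grG _ _ _ rho1 xr yr) eG.
Qed.

End Shear.

(** * Local persistence of solutions and their continuation from t = 1 to t = 0 *)

Section LocalOpenness.
Variable R : realType.
Local Notation C := R[i].
Variables (f1 f2 : C -> C -> C) (c1 c2 : C) (M : R).
Hypothesis cf1 : cont2C f1.
Hypothesis cf2 : cont2C f2.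
Hypothesis elim : forall s, s != 0 -> exists T : {poly {poly C}}, forall t X,
  (map_poly (horner_eval t) T).[X] = 0 <->
  exists2 y, f1 (X + s * y) y = t * c1 & f2 (X + s * y) y = t * c2.
Hypothesis bounded : forall t x y, normc t <= 2 ->
  f1 x y = t * c1 -> f2 x y = t * c2 -> normc x <= M /\ normc y <= M.

(** The values x - s y are roots of the elimination polynomial at t. It is not zero, since otherwise
    every X would be such a value, although the fibre is bounded. *)
Lemma fibre_projection_finite t s : normc t <= 2 -> s != 0 ->
  exists A : seq C, forall x y,
    f1 x y = t * c1 -> f2 x y = t * c2 -> x - s * y \in A.
Proof.
move=> t2 s0; have [T TP] := elim s0.
have T0 : map_poly (horner_eval t) T != 0.
  apply/eqP => T0.
  (* This X is larger than |x - s y| can be when |x| and |y| are at most [M]. *)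
  have [|y e1 e2] := (TP t (`|M| + normc s * `|M| + 1)%:C).1; first by rewrite T0 horner0.
  have [bx by_] := bounded t2 e1 e2.
  have : normc (`|M| + normc s * `|M| + 1)%:C <=
      normc ((`|M| + normc s * `|M| + 1)%:C + s * y) + normc s * normc y.
    by rewrite -normcM -[X in _ <= _ + X]normcN -{1}[X in normc X](addrK (s * y)) le_normcD.
  have nM := ler_norm M; have ns := normc_ge0 s.
  have : normc s * normc y <= normc s * `|M| by rewrite ler_wpM2l // (le_trans by_).
  have sM : 0 <= normc s * `|M| by rewrite mulr_ge0.
  rewrite normc_real => le1 le2; have := ler_norm (`|M| + normc s * `|M| + 1).
  by lra.
have [A AP] := poly_roots_seq T0; exists A => x y e1 e2; apply: AP.
by apply/rootP/(TP t (x - s * y)).2; exists y; rewrite subrK.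
Qed.

(** The projections x - y and x - 2y take finitely many values on the fibre and together determine
    the point, so only finitely many slopes join (x0,y0) to another point of the fibre. *)
Lemma fibre_separating_slope t x0 y0 : normc t <= 2 ->
  exists2 s, s != 0 & forall x y, f1 x y = t * c1 -> f2 x y = t * c2 ->
    x - s * y = x0 - s * y0 -> x = x0 /\ y = y0.
Proof.
move=> t2; have [A AP] := fibre_projection_finite t2 (oner_neq0 _).
have two0 : 2%:R != 0 :> C by rewrite pnatr_eq0.
have [B BP] := fibre_projection_finite t2 two0.
(* From a = x - y and b = x - 2y one recovers x = 2a - b and y = a - b; [bad a b] is (x - x0) / (y -
   y0). *)
pose bad a b : C := (2 * a - b - x0) / (a - b - y0).
have [s] := exists_notin_seq (0 :: [seq bad a b | a <- A, b <- B]).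
rewrite in_cons negb_or => /andP[s0 sbad]; exists s => // x y e1 e2 line.
suff yy : y = y0 by split=> //; rewrite -[LHS](subrK (s * y)) line yy subrK.
apply/eqP; rewrite -subr_eq0; apply: contraNT sbad => ny.
apply/allpairsP; exists (x - 1 * y, x - 2%:R * y); rewrite AP // BP //; split=> //=.
rewrite /bad; have -> : 2 * (x - 1 * y) - (x - 2%:R * y) - x0 = x - x0 by ring.
have -> : x - 1 * y - (x - 2%:R * y) - y0 = y - y0 by ring.
have -> : x - x0 = s * (y - y0).
  apply/eqP; rewrite -subr_eq0.
  have -> : x - x0 - s * (y - y0) = (x - s * y) - (x0 - s * y0) by ring.
  by rewrite line subrr.
by rewrite mulfK.
Qed.

(** With a separating slope, (x0,y0) is the only zero of [h], so by compactness [h] is at least some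
    [kappa] on bounded points at distance [eps] or more from it. Root perturbation gives a solution
    at t with [h] below [kappa], hence a near one. *)
Lemma fibre_open t0 x0 y0 (eps : R) : normc t0 <= 1 -> 0 < eps ->
  f1 x0 y0 = t0 * c1 -> f2 x0 y0 = t0 * c2 ->
  exists2 delta, 0 < delta & forall t, normc (t - t0) < delta ->
    exists x y, [/\ f1 x y = t * c1, f2 x y = t * c2,
                    normc (x - x0) < eps & normc (y - y0) < eps].
Proof.
move=> t01 eps0 e1 e2; have t02 : normc t0 <= 2 by lra.
have [s s0 sep] := fibre_separating_slope x0 y0 t02.
pose X0 := x0 - s * y0.
pose h x y := normc (f1 x y + - (t0 * c1)) + normc (f2 x y + - (t0 * c2)) +
  normc (x + (- s) * y + - X0).
pose psi (x y : C) := Num.min (M + - normc x) (Num.min (M + - normc y)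
  (Num.max (normc (x + - x0)) (normc (y + - y0)) + - eps)).
have ch : cont2R h.
  by do !apply: cont2RD; apply: cont2R_normc; do !apply: cont2CD;
    do ?apply: cont2CM; by [| exact: cont2C_cst | exact: cont2C_fst | exact: cont2C_snd].
have cpsi : cont2R psi.
  have ca : cont2C (fun x _ : C => x + - x0).
    by apply: cont2CD; [exact: cont2C_fst | exact: cont2C_cst].
  have cb : cont2C (fun _ y : C => y + - y0).
    by apply: cont2CD; [exact: cont2C_snd | exact: cont2C_cst].
  do !apply: cont2R_min; apply: cont2RD; try exact: cont2R_cst.
  - by apply: cont2RN; apply: cont2R_normc; exact: cont2C_fst.
  - by apply: cont2RN; apply: cont2R_normc; exact: cont2C_snd.
  - by apply: cont2R_max; exact: cont2R_normc.
have [x y|x y psi0|kappa kappa0 le_h] := cont2R_pos_bound (M := M) ch cpsi.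
- by rewrite !le_min => /and3P[]; rewrite !subr_ge0.
- rewrite lt_def !addr_ge0 ?normc_ge0 // andbT; apply: contraTN psi0.
  rewrite !paddr_eq0 ?addr_ge0 ?normc_ge0 // !normc_eq0 -andbA => /and3P[].
  rewrite !subr_eq0 mulNr => /eqP d1 /eqP d2 /eqP d3.
  have [-> ->] := sep _ _ d1 d2 d3.
  by rewrite /psi !le_min !subrr normc0 maxxx add0r oppr_ge0 (leNgt eps) eps0 !andbF.
have [T TP] := elim s0.
(* Half of [kappa] is spent on the shift of X, the other half on the shift of t in the two
   equations. *)
have [| | |d d0 dP] := @root_perturbation _ T t0 X0 (kappa / 2).
- by rewrite divr_gt0.
- apply/eqP => T0.
  have [A AP] := fibre_projection_finite t02 s0.
  have [X] := exists_notin_seq A; case/negP.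
  have [|y E1 E2] := (TP t0 X).1; first by rewrite T0 horner0.
  by have := AP _ _ E1 E2; rewrite addrK.
- by apply/(TP t0 X0).2; exists y0; rewrite subrK.
pose n := normc c1 + normc c2 + 1.
have n0 : 0 < n by rewrite ltr_wpDl ?addr_ge0 ?normc_ge0.
(* The bound 1 keeps |t| <= 2, the range in which fibres are bounded. *)
exists (Num.min d (Num.min 1 (kappa / 2 / n))) => [|t].
  by rewrite !lt_min d0 ltr01 !divr_gt0.
rewrite !lt_min ltr_pdivlMr // => /and3P[td t1 tn].
have [X ltX /(TP t X).1[y E1 E2]] := dP t td.
have t2 : normc t <= 2.
  by have := le_normcB_dist t t0 0; rewrite !subr0; lra.
have [bx by_] := bounded t2 E1 E2.
exists (X + s * y), y.
have : h (X + s * y) y < kappa.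
  rewrite /h E1 E2 -!mulrBl !normcM mulNr addrK.
  have : normc (t - t0) * normc c1 + normc (t - t0) * normc c2 <= normc (t - t0) * n.
    by rewrite -mulrDr ler_wpM2l ?normc_ge0 // lerDl.
  by rewrite /X0 in ltX *; lra.
move=> lt_h; have : psi (X + s * y) y < 0.
  by rewrite ltNge; apply/negP => /le_h; rewrite leNgt lt_h.
rewrite /psi !gt_min !subr_lt0 !(ltNge M) bx by_ /= gt_max => /andP[lx ly].
by split.
Qed.

Variables (m1 m2 : C) (r1 r2 : R).

Let inK x y := normc (x - m1) <= r1 /\ normc (y - m2) <= r2.

Hypothesis no_boundary : forall (t : R) x y, 0 <= t <= 1 -> inK x y ->
  f1 x y = t%:C * c1 -> f2 x y = t%:C * c2 ->
  normc (x - m1) < r1 /\ normc (y - m2) < r2.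

Lemma polydisc_pos_bound (h : C -> C -> R) : cont2R h ->
  (forall x y, inK x y -> 0 < h x y) ->
  exists2 kappa, 0 < kappa & forall x y, inK x y -> kappa <= h x y.
Proof.
move=> ch h0.
pose psi (x y : C) := Num.min (r1 + - normc (x + - m1)) (r2 + - normc (y + - m2)).
have psiP x y : 0 <= psi x y <-> inK x y.
  by rewrite le_min !subr_ge0; split=> [/andP[]|[-> ->]].
have cpsi : cont2R psi.
  apply: cont2R_min; (apply: cont2RD; first exact: cont2R_cst);
    apply: cont2RN; apply: cont2R_normc; apply: cont2CD;
    by [exact: cont2C_cst | exact: cont2C_fst | exact: cont2C_snd].
pose M0 := `|r1| + `|r2| + normc m1 + normc m2.
have [x y /psiP[bx by_]|x y /psiP/h0 //|kappa k0 kP] := cont2R_pos_bound (M := M0) ch cpsi.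
  have := le_normcB_dist x m1 0; have := le_normcB_dist y m2 0.
  rewrite /M0 !subr0; have := ler_norm r1; have := ler_norm r2.
  have := normr_ge0 r1; have := normr_ge0 r2.
  by have := normc_ge0 m1; have := normc_ge0 m2; move=> *; split; lra.
by exists kappa => // x y /psiP; exact: kP.
Qed.

(** Consider the infimum [t0] of the parameters having a solution in the closed polydisc. It is
    attained by compactness; if it were positive, its solution would be interior and would persist
    for slightly smaller t. *)
Lemma fibre_continuation x1 y1 : inK x1 y1 -> f1 x1 y1 = c1 -> f2 x1 y1 = c2 ->
  exists x y, [/\ inK x y, f1 x y = 0 & f2 x y = 0].
Proof.
move=> K1 e1 e2.
pose S : set R := [set t | 0 <= t <= 1 /\
  exists x y, [/\ inK x y, f1 x y = t%:C * c1 & f2 x y = t%:C * c2]]%classic.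
have S1 : S 1 by split; [rewrite ler01 lexx | exists x1, y1; rewrite !mul1r].
have Slb : has_lbound S by exists 0 => t [/andP[]].
have Sinf : has_inf S by split; [exists 1 | ].
pose t0 := inf S.
have t0P : 0 <= t0 <= 1.
  rewrite lb_le_inf /=; last by move=> t [/andP[]].
  - exact: ge_inf.
  - by exists 1.
pose n := normc c1 + normc c2 + 1.
have n0 : 0 < n by rewrite ltr_wpDl ?addr_ge0 ?normc_ge0.
(* Without a solution at [t0] the residual [h] would be bounded below, but solutions for t close to
   [t0] make it arbitrarily small. *)
have St0 : S t0.
  apply: contrapT => nS.
  pose h x y := normc (f1 x y + - (t0%:C * c1)) + normc (f2 x y + - (t0%:C * c2)).
  have [||kappa k0 kP] := @polydisc_pos_bound h.
  - by apply: cont2RD; apply: cont2R_normc; apply: cont2CD => //; exact: cont2C_cst.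
  - move=> x y Kxy; rewrite lt_def addr_ge0 ?normc_ge0 // andbT.
    apply: contra_notN nS; rewrite paddr_eq0 ?normc_ge0 // !normc_eq0 !subr_eq0.
    by move=> /andP[/eqP E1 /eqP E2]; split=> //; exists x, y.
  have [t [tP [x [y [Kxy E1 E2]]]] lt_t] := inf_adherent (divr_gt0 k0 n0) Sinf.
  have le_t : t0 <= t by apply: ge_inf => //; split=> //; exists x, y.
  have := kP _ _ Kxy; rewrite leNgt => /negP; apply.
  rewrite /h E1 E2 -!mulrBl !normcM -rmorphB normc_real ger0_norm ?subr_ge0 //.
  rewrite -mulrDr; apply: (@le_lt_trans _ _ ((t - t0) * n)).
    by rewrite ler_wpM2l ?subr_ge0 // lerDl.
  by rewrite -ltr_pdivlMr // ltrBlDl.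
have [_ [x0 [y0 [K0 E1 E2]]]] := St0.
have [t00|t0_gt0] := eqVneq t0 0.
  by exists x0, y0; rewrite E1 E2 t00 !mul0r.
have [b1 b2] := no_boundary t0P K0 E1 E2.
have {}t0_gt0 : 0 < t0 by rewrite lt_def t0_gt0; case/andP: t0P.
pose eps := Num.min (r1 - normc (x0 - m1)) (r2 - normc (y0 - m2)).
have eps0 : 0 < eps by rewrite lt_min !subr_gt0 b1.
have nt0 : normc t0%:C <= 1 by rewrite normc_real ger0_norm //; case/andP: t0P.
have [d d0 dP] := fibre_open nt0 eps0 E1 E2.
(* A parameter below [t0], within [d], and kept in [0,1]. *)
pose t := Num.max 0 (t0 - d / 2).
have lt_t : t < t0 by rewrite gt_max t0_gt0 gtrBl divr_gt0.
have t_ge0 : 0 <= t by rewrite le_max lexx.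
have le_t : t0 - t <= d / 2.
  by rewrite lerBlDr -lerBlDl le_max lexx orbT.
have [|x [y [F1 F2 lx ly]]] := dP t%:C.
  by rewrite -rmorphB normc_real distrC ger0_norm ?subr_ge0 ?(ltW lt_t) //; lra.
suff : S t by move=> /(ge_inf Slb); rewrite leNgt lt_t.
split; first by rewrite t_ge0 (le_trans (ltW lt_t)) //; case/andP: t0P.
exists x, y; split=> //; move: lx ly; rewrite !lt_min => /andP[l1 _] /andP[_ l2].
have := le_normcB_dist x x0 m1; have := le_normcB_dist y y0 m2.
by split; lra.
Qed.

End LocalOpenness.

(** * A common zero in the polydisc from the boundary estimates *)

Section PolydiscZero.
Variable R : realType.
Local Notation C := R[i].
Variables (f g : {poly {poly C}}) (m1 m2 : C) (r1 r2 U1 V1 L1 U2 V2 L2 : R).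
Let ev (P : {poly {poly C}}) (x y : C) := P.[y%:P].[x].
Let inK x y := normc (x - m1) <= r1 /\ normc (y - m2) <= r2.
Let S (U V : R) x y := U * normc (ev f x y) + V * normc (ev g x y).
Hypothesis boundary1 : forall x y,
  normc (x - m1) = r1 -> normc (y - m2) <= r2 -> L1 <= S U1 V1 x y.
Hypothesis boundary2 : forall x y,
  normc (x - m1) <= r1 -> normc (y - m2) = r2 -> L2 <= S U2 V2 x y.

(** Without a common zero, |f| + |g| is at least some [kappa] on the closed polydisc. A perturbation
    small against [kappa] and against the slack in both inequalities keeps the boundary free of
    solutions, so continuation yields a zero of the perturbed system, where |f| + |g| is too
    small. *)
Lemma polydisc_common_zero x0 y0 :
  0 <= U1 -> 0 <= V1 -> 0 <= U2 -> 0 <= V2 -> inK x0 y0 -> S U1 V1 x0 y0 < L1 ->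
  S U2 V2 x0 y0 < L2 -> exists x y, [/\ inK x y, ev f x y = 0 & ev g x y = 0].
Proof.
move=> U1_ge0 V1_ge0 U2_ge0 V2_ge0 K0 S1 S2; apply: contrapT => nozero.
pose h x y := normc (ev f x y) + normc (ev g x y).
have [||kappa kappa0 kP] := @polydisc_pos_bound R m1 m2 r1 r2 h.
- by apply: cont2RD; apply: cont2R_normc; exact: cont2C_horner.
- move=> x y Kxy; rewrite lt_def addr_ge0 ?normc_ge0 // andbT.
  apply: contra_notN nozero; rewrite paddr_eq0 ?normc_ge0 // !normc_eq0.
  by move=> /andP[/eqP E1 /eqP E2]; exists x, y.
have [n1 tf] := total_degree_le_exists f; have [n2 tg] := total_degree_le_exists g.
pose n := maxn n1 n2.
have {}tf : total_degree_le n f by apply: total_degree_leW tf; exact: leq_maxl.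
have {}tg : total_degree_le n g by apply: total_degree_leW tg; exact: leq_maxr.
pose B := (normc m1 + normc m2 + `|r1| + `|r2| + 1) ^+ n.+1.
have KB x y : inK x y -> normc x ^+ n.+1 <= B /\ normc y ^+ n.+1 <= B.
  move=> [bx by_]; have := le_normcB_dist x m1 0; have := le_normcB_dist y m2 0.
  rewrite !subr0; have := ler_norm r1; have := ler_norm r2.
  have := normr_ge0 r1; have := normr_ge0 r2.
  have := normc_ge0 m1; have := normc_ge0 m2; move=> *.
  by split; rewrite /B lerXn2r ?nnegrE ?normc_ge0 //; lra.
have B0 : 0 < B.
  rewrite exprn_gt0 //; have := normr_ge0 r1; have := normr_ge0 r2.
  by have := normc_ge0 m1; have := normc_ge0 m2; move=> *; lra.
pose gap := Num.min kappa (Num.min (L1 - S U1 V1 x0 y0) (L2 - S U2 V2 x0 y0)).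
have gap0 : 0 < gap by rewrite !lt_min kappa0 !subr_gt0 S1.
pose W := 1 + U1 + V1 + U2 + V2.
have W0 : 0 < W by rewrite /W; lra.
(* Each perturbing term is at most eps B on the polydisc. It enters once at (x,y) and once at
   (x0,y0), so a weighted sum moves by at most 2 eps B W, half of [gap]. *)
pose eps := gap / (4 * B * W).
have eps0 : 0 < eps by rewrite divr_gt0 // !mulr_gt0.
have epsB : 4 * (eps * B) * W = gap.
  by rewrite /eps; field; rewrite !gt_eqF.
pose F x y := ev f x y + eps%:C * x ^+ n.+1.
pose G x y := ev g x y + eps%:C * y ^+ n.+1.
pose c1 := F x0 y0; pose c2 := G x0 y0.
have eB0 : 0 < eps * B by rewrite mulr_gt0.
have near x y : inK x y ->
    [/\ normc (F x y) <= normc (ev f x y) + eps * B,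
        normc (ev f x y) <= normc (F x y) + eps * B,
        normc (G x y) <= normc (ev g x y) + eps * B &
        normc (ev g x y) <= normc (G x y) + eps * B].
  move=> /KB[bx by_].
  have pert (w z : C) : normc z ^+ n.+1 <= B ->
      normc (w + eps%:C * z ^+ n.+1) <= normc w + eps * B /\
      normc w <= normc (w + eps%:C * z ^+ n.+1) + eps * B.
    move=> bz; have le_e : normc (eps%:C * z ^+ n.+1) <= eps * B.
      by rewrite normcM normcX normc_real ger0_norm ?(ltW eps0) // ler_pM2l.
    have := le_normcD w (eps%:C * z ^+ n.+1).
    have := le_normcD (w + eps%:C * z ^+ n.+1) (- (eps%:C * z ^+ n.+1)).
    by rewrite addrK normcN; split; lra.
  by have [? ?] := pert (ev f x y) x bx; have [? ?] := pert (ev g x y) y by_.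
have cF : cont2C F.
  apply: cont2CD; first exact: cont2C_horner.
  by apply: cont2CM; [exact: cont2C_cst | apply: cont2CX; exact: cont2C_fst].
have cG : cont2C G.
  apply: cont2CD; first exact: cont2C_horner.
  by apply: cont2CM; [exact: cont2C_cst | apply: cont2CX; exact: cont2C_snd].
have elimFG s : s != 0 -> exists T : {poly {poly C}}, forall t X,
  (map_poly (horner_eval t) T).[X] = 0 <->
  exists2 y, F (X + s * y) y = t * c1 & G (X + s * y) y = t * c2.
  move=> s0; apply: elimination_perturbed => //.
  by rewrite -normc_eq0 normc_real normr_eq0 gt_eqF.
have [M bnd] := perturbed_bounded c1 c2 eps0 tf tg.
have small U V x y (t : R) : 0 <= U -> 0 <= V -> 4 * (eps * B) * (U + V) <= 4 * (eps * B) * W ->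
    0 <= t <= 1 -> inK x y -> F x y = t%:C * c1 -> G x y = t%:C * c2 ->
    S U V x y < S U V x0 y0 + gap.
  move=> U0 V0 leW /andP[t0 t1] Kxy E1 E2.
  have [_ l1 _ l2] := near _ _ Kxy; have [l3 _ l4 _] := near _ _ K0.
  rewrite E1 E2 !normcM normc_real ger0_norm // in l1 l2.
  rewrite -/c1 in l3; rewrite -/c2 in l4.
  have tc (c : C) : t * normc c <= normc c by rewrite ler_piMl ?normc_ge0.
  have := tc c1; have := tc c2 => tc2 tc1.
  have a1 : U * normc (ev f x y) <= U * (normc (ev f x0 y0) + 2 * (eps * B)).
    by rewrite ler_wpM2l //; lra.
  have a2 : V * normc (ev g x y) <= V * (normc (ev g x0 y0) + 2 * (eps * B)).
    by rewrite ler_wpM2l //; lra.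
  rewrite /S -epsB; rewrite !mulrDr in a1 a2.
  have : 0 <= U * (eps * B) by rewrite mulr_ge0 // ltW.
  have : 0 <= V * (eps * B) by rewrite mulr_ge0 // ltW.
  have := mulr_gt0 eB0 W0.
  by rewrite -epsB in gap0; nra.
have inner (t : R) x y : 0 <= t <= 1 -> inK x y -> F x y = t%:C * c1 ->
    G x y = t%:C * c2 -> normc (x - m1) < r1 /\ normc (y - m2) < r2.
  move=> t01 Kxy E1 E2; have [bx by_] := Kxy.
  have leW U V : U + V <= W -> 4 * (eps * B) * (U + V) <= 4 * (eps * B) * W.
    by move=> ?; rewrite ler_wpM2l // mulr_ge0 // ltW.
  have gap1 : gap <= L1 - S U1 V1 x0 y0 by rewrite !ge_min lexx orbT.
  have gap2 : gap <= L2 - S U2 V2 x0 y0 by rewrite !ge_min lexx !orbT.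
  have lt1 : S U1 V1 x y < L1.
    have := small _ _ _ _ _ U1_ge0 V1_ge0 (leW _ _ _) t01 Kxy E1 E2.
    by rewrite /W => /(_ ltac:(lra)); lra.
  have lt2 : S U2 V2 x y < L2.
    have := small _ _ _ _ _ U2_ge0 V2_ge0 (leW _ _ _) t01 Kxy E1 E2.
    by rewrite /W => /(_ ltac:(lra)); lra.
  split; rewrite lt_neqAle ?bx ?by_ andbT; apply/eqP => e.
    by have := boundary1 e by_; rewrite leNgt lt1.
  by have := boundary2 bx e; rewrite leNgt lt2.
have [x [y [Kxy E1 E2]]] :=
  fibre_continuation cF cG elimFG bnd inner K0 (erefl c1) (erefl c2).
have [_ l1 _ l2] := near _ _ Kxy.
have := kP _ _ Kxy; rewrite /h; rewrite E1 E2 normc0 in l1 l2.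
have : gap <= kappa by rewrite ge_min lexx.
(* At this point |f| + |g| <= 2 eps B, less than [gap] because [W] is at least 1. *)
have := mulr_gt0 eB0 W0; rewrite -epsB /W.
have := mulr_ge0 (ltW eB0) U1_ge0; have := mulr_ge0 (ltW eB0) V1_ge0.
have := mulr_ge0 (ltW eB0) U2_ge0; have := mulr_ge0 (ltW eB0) V2_ge0.
by nra.
Qed.

End PolydiscZero.

(** * The cofactor identity *)

(** A column operation of determinant 1 turns column 0 of the Sylvester matrix into the products y^k
    F and y^k G. Expanding along that column and collecting the multiples of [F] and of [G] gives
    the two cofactor determinants. *)
Lemma resultant_syl_cof (F G : {poly {poly int}}) :
  (0 < (size G).-1 + (size F).-1)%N ->
  (resultant F G)%:P = syl_cof_u F G * F + syl_cof_v F G * G.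
Proof.
set dq := (size G).-1; set dp := (size F).-1 => dS0.
pose dS := (dq + dp)%N; pose j0 : 'I_dS := Ordinal dS0.
pose T : 'M[{poly {poly int}}]_dS := map_mx polyC (Sylvester_mx F G).
pose E : 'M[{poly {poly int}}]_dS :=
  \matrix_(i, j) if j == 0%N :> nat then 'X^i else (i == j)%:R.
(* Right multiplication by the unitriangular [E] replaces column 0 of [T] by
   the combination of all columns with weights ['X^j]. *)
have detE : \det E = 1.
  rewrite det_trig; last first.
    apply/is_trig_mxP => i j lij; rewrite mxE.
    by rewrite -[j == 0%N :> nat]negbK -lt0n (leq_trans _ lij) //=
       -val_eqE /= ltn_eqF.
  apply: big1 => i _; rewrite mxE eqxx.
  by case: eqP => // ->; rewrite expr0.
have TEj (i j : 'I_dS) : j != 0%N :> nat -> (T *m E) i j = T i j.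
  move=> j_neq0; rewrite mxE (bigD1 j) //= [E j j]mxE (negPf j_neq0) eqxx mulr1.
  rewrite big1 ?addr0 // => k nkj.
  by rewrite [E k j]mxE (negPf j_neq0) (negPf nkj) mulr0.
have TE0 i : (T *m E) i j0 =
    match split i with inl k => 'X^k * F | inr k => 'X^k * G end.
  rewrite mxE; apply/polyP => n.
  (* The row sum is the row polynomial truncated at degree [dS]; nothing is lost, since y^k F and
     y^k G have degree below [dS]. *)
  transitivity (if (n < dS)%N then
     (match split i with inl k => 'X^k * F | inr k => 'X^k * G end)`_n else 0).
    under eq_bigr => j _ do rewrite [T _ _]mxE [E _ _]mxE /= Sylvester_mxE.
    set W := match split i with inl _ => _ | inr _ => _ end.
    rewrite -(coef_poly dS (fun n => W`_n)) poly_def; congr ((_ : {poly {poly int}})`_n).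
    apply: eq_bigr => j _; rewrite -mul_polyC; congr (_%:P * _).
    by rewrite /W; case: (split i) => k; rewrite coefXnM; case: leqP.
  case: ltnP => [_|le_dS_n]; first by case: (split i).
  have szX k (P : {poly {poly int}}) : size ('X^k * P) = (size P + k)%N \/ 'X^k * P = 0.
    have [->|P0] := eqVneq P 0; first by right; rewrite mulr0.
    by left; rewrite size_monicM ?monicXn // size_polyXn /=  addnC.
  have step (m k: nat) (P : {poly {poly int}}) :
     (k < m)%N -> (m + (size P).-1 <= n)%N -> 0 = ('X^k * P)`_n.
    move=> km mn; case: (szX k P) => [e|->]; last by rewrite coef0.
    rewrite nth_default // e (leq_trans _ mn) //.
    by case: (size P) => [|s]; rewrite ?add0n ?(leq_trans (ltnW km)) ?leq_addr //
      addSnnS addnC leq_add2r.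
  case: (split i) => k; first exact: (step _ _ _ (ltn_ord k)).
  by apply: (step _ _ _ (ltn_ord k)); rewrite addnC.
(* Cofactors along column 0 do not see that column, so all the matrices involved share them. *)
have cofE (M N : 'M[{poly {poly int}}]_dS) :
    (forall i (j : 'I_dS), j != 0%N :> nat -> M i j = N i j) ->
    forall i, cofactor M i j0 = cofactor N i j0.
  move=> eMN i; congr (_ * \det _); apply/matrixP => i' j'; rewrite !mxE.
  by apply: eMN.
rewrite /resultant -det_map_mx -/T -[\det T]mulr1 -detE -det_mulmx.
rewrite (expand_det_col _ j0) /syl_cof_u /syl_cof_v.
rewrite (expand_det_col _ j0) [X in _ + X * _](expand_det_col _ j0).
rewrite !mulr_suml -big_split /=; apply: eq_bigr => i _.
rewrite TE0 (cofE _ T TEj) !mxE.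
rewrite !(cofE _ T) => [|k l nl|k l nl]; first last.
- by rewrite [LHS]mxE (negPf nl) [T k l]mxE.
- by rewrite [LHS]mxE (negPf nl) [T k l]mxE.
case: (split i) => k; rewrite ?(mul0r, add0r, addr0) //.
  by rewrite mulrAC.
by rewrite mulrAC.
Qed.

Section Evaluation.
Variable T : comNzRingType.
Implicit Types (F G : {poly {poly int}}) (p : {poly int}) (x y : T).

Lemma eval2D F G x y : eval2 (F + G) x y = eval2 F x y + eval2 G x y.
Proof. by rewrite /eval2 rmorphD !hornerD. Qed.

Lemma eval2M F G x y : eval2 (F * G) x y = eval2 F x y * eval2 G x y.
Proof. by rewrite /eval2 rmorphM !hornerM. Qed.

Lemma eval2_polyC p x y : eval2 p%:P x y = (map_poly intr p).[x].
Proof. by rewrite /eval2 map_polyC hornerC. Qed.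

Lemma eval2_map_polyC p x y : eval2 p^:P x y = (map_poly intr p).[y].
Proof.
rewrite /eval2 -map_poly_comp.
rewrite (eq_map_poly (_ : _ =1 polyC \o (intr : int -> T))).
  by rewrite map_poly_comp horner_map hornerC.
by move=> k /=; rewrite map_polyC.
Qed.

End Evaluation.

Section Resultants.
Variables (T : comNzRingType) (f g : {poly {poly int}}).

(** If both polynomials are constant in the outer variable, the Sylvester matrix is empty and its
    determinant is 1. *)
Lemma size_resultant_gt1 F G : (1 < size (resultant F G : {poly int}))%N ->
  (0 < (size G).-1 + (size F).-1)%N.
Proof.
apply: contraTltn; rewrite leqn0 => /eqP dS0.
have det0 n (A : 'M[{poly int}]_n) : n = 0%N -> \det A = 1.
  by move=> n0; move: A; rewrite n0 => A; rewrite det_mx00.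
by rewrite /resultant det0 // size_poly1.
Qed.

Lemma Ry_cofactors (x y : T) : (1 < size (Ry f g))%N ->
  (map_poly intr (Ry f g)).[x] =
    eval2 (uy f g) x y * eval2 f x y + eval2 (vy f g) x y * eval2 g x y.
Proof.
move=> /size_resultant_gt1/resultant_syl_cof RE.
by rewrite -!eval2M -eval2D -(eval2_polyC _ _ y) [in LHS]RE.
Qed.

Lemma Rx_cofactors (x y : T) : (1 < size (Rx f g))%N ->
  (map_poly intr (Rx f g)).[y] =
    eval2 (ux f g) x y * eval2 f x y + eval2 (vx f g) x y * eval2 g x y.
Proof.
move=> /size_resultant_gt1/resultant_syl_cof/(congr1 swapXY).
rewrite swapXY_polyC rmorphD !rmorphM /= !swapXYK => RE.
by rewrite -!eval2M -eval2D -(eval2_map_polyC _ x) [in LHS]RE.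
Qed.

End Resultants.

(** * From complex estimates to the statement over the reals *)

Section ComplexBounds.
Variable R : realType.

Lemma in_discE (c rho : R) (z : R[i]) : in_disc c rho z = (normc (z - c%:C) < rho).
Proof. by rewrite /in_disc normC_normc ltcR. Qed.

Lemma in_cdiscE (c rho : R) (z : R[i]) : in_cdisc c rho z = (normc (z - c%:C) <= rho).
Proof. by rewrite /in_cdisc normC_normc lecR. Qed.

Lemma eval2_real (f : {poly {poly int}}) (x y : R) :
  eval2 f x%:C y%:C = (eval2 f x y)%:C.
Proof.
rewrite /eval2.
have -> : map_poly (map_poly (intr : int -> R[i])) f =
    map_poly (map_poly (real_complex R)) (map_poly (map_poly intr) f).
  rewrite -map_poly_comp; apply: eq_map_poly => p /=; exact: intCE.
have -> : (y%:C)%:P = map_poly (real_complex R) y%:P by rewrite map_polyC.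
by rewrite horner_map (horner_map (real_complex R)).
Qed.

(** The bound is tested at the centre of the polydisc. *)
Lemma upper_bound_ge0 (m1 m2 r1 r2 U : R) (e : R[i] -> R[i] -> R[i]) :
  0 < r1 -> 0 < r2 ->
  (forall z1 z2, in_cdisc m1 (2 * r1) z1 -> in_cdisc m2 (2 * r2) z2 ->
     `|e z1 z2| <= U%:C) -> 0 <= U.
Proof.
move=> r10 r20 /(_ m1%:C m2%:C); rewrite !in_cdiscE !subrr normc0 => bnd.
have := bnd (ltW (mulr_gt0 (ltr0Sn _ 1) r10)) (ltW (mulr_gt0 (ltr0Sn _ 1) r20)).
by rewrite normC_normc lecR; apply: le_trans; exact: normc_ge0.
Qed.

Lemma resultant_boundary (P : {poly int}) (r : nat -> {poly int}) (i0 : nat)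
    (alpha a b U V : R) (u v s t z : R[i]) :
  sqfree_factorization P r -> admissible_interval P r i0 alpha a b ->
  normc (z - ((a + b) / 2)%:C) = 2 * ((b - a) / 2) ->
  (map_poly intr P).[z] = u * s + v * t ->
  `|u| <= U%:C -> `|v| <= V%:C ->
  Lbound P i0 a b <= U * normc s + V * normc t.
Proof.
move=> [fact _ _] adm ez Pz; rewrite !normC_normc !lecR => uU vV.
apply: le_trans (admissible_Lbound fact adm ez) _.
rewrite /intC Pz (le_trans (le_normcD _ _)) // !normcM.
by rewrite lerD // ler_wpM2r ?normc_ge0.
Qed.

End ComplexBounds.

Theorem theorem4 (R : realType) (f g : {poly {poly int}})
  (rY rX : nat -> {poly int}) (i0 j0 : nat) (alpha beta a b c d : R)
  (Uuy Uvy Uux Uvx : R) :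
  no_common_factor2 f g ->
  (* alpha : real root of R^(y), interval I = (a,b) as in the construction *)
  (map_poly (intr : int -> R) (Ry f g)).[alpha] = 0 ->
  sqfree_factorization (Ry f g) rY ->
  admissible_interval (Ry f g) rY i0 alpha a b ->
  (* beta : real root of R^(x), interval J = (c,d) as in the construction *)
  (map_poly (intr : int -> R) (Rx f g)).[beta] = 0 ->
  sqfree_factorization (Rx f g) rX ->
  admissible_interval (Rx f g) rX j0 beta c d ->
  (* upper bounds for the cofactors on the closed polydisc *)
  let mI := (a + b) / 2 in let rI := (b - a) / 2 in
  let mJ := (c + d) / 2 in let rJ := (d - c) / 2 in
  (forall z1 z2 : R[i], in_cdisc mI (2 * rI) z1 -> in_cdisc mJ (2 * rJ) z2 ->
     `|eval2 (uy f g) z1 z2| <= Uuy%:C) ->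
  (forall z1 z2 : R[i], in_cdisc mI (2 * rI) z1 -> in_cdisc mJ (2 * rJ) z2 ->
     `|eval2 (vy f g) z1 z2| <= Uvy%:C) ->
  (forall z1 z2 : R[i], in_cdisc mI (2 * rI) z1 -> in_cdisc mJ (2 * rJ) z2 ->
     `|eval2 (ux f g) z1 z2| <= Uux%:C) ->
  (forall z1 z2 : R[i], in_cdisc mI (2 * rI) z1 -> in_cdisc mJ (2 * rJ) z2 ->
     `|eval2 (vx f g) z1 z2| <= Uvx%:C) ->
  (exists x0 y0 : R[i],
     [/\ in_disc mI (2 * rI) x0, in_disc mJ (2 * rJ) y0,
         Uuy%:C * `|eval2 f x0 y0| + Uvy%:C * `|eval2 g x0 y0|
           < (Lbound (Ry f g) i0 a b)%:C &
         Uux%:C * `|eval2 f x0 y0| + Uvx%:C * `|eval2 g x0 y0|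
           < (Lbound (Rx f g) j0 c d)%:C]) ->
  (exists z1 z2 : R[i],
     [/\ in_disc mI (2 * rI) z1, in_disc mJ (2 * rJ) z2,
         eval2 f z1 z2 = 0 & eval2 g z1 z2 = 0])
  /\ eval2 f alpha beta = 0.
Proof.
move=> _ _ facY admY _ facX admX mI rI mJ rJ bUuy bUvy bUux bUvx.
move=> [x0 [y0 [Dx0 Dy0 S1 S2]]].
have rI0 : 0 < rI := admissible_rad_gt0 admY.
have rJ0 : 0 < rJ := admissible_rad_gt0 admX.
(* The index [i0] lies between 1 and the degree, so the resultant is not constant. *)
have szY : (1 < size (Ry f g))%N.
  case: admY => /andP[i0_gt0 /(leq_trans i0_gt0) sz] _ _ _ _.
  by case: (size (Ry f g)) sz => [|[]].
have szX : (1 < size (Rx f g))%N.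
  case: admX => /andP[j0_gt0 /(leq_trans j0_gt0) sz] _ _ _ _.
  by case: (size (Rx f g)) sz => [|[]].
have Uuy0 := upper_bound_ge0 rI0 rJ0 bUuy.
have Uvy0 := upper_bound_ge0 rI0 rJ0 bUvy.
have Uux0 := upper_bound_ge0 rI0 rJ0 bUux.
have Uvx0 := upper_bound_ge0 rI0 rJ0 bUvx.
pose cpl (h : {poly {poly int}}) := map_poly (map_poly (intr : int -> R[i])) h.
rewrite !in_discE in Dx0 Dy0.
rewrite !normC_normc -!rmorphM -!rmorphD !ltcR in S1 S2.
have bdY x y : normc (x - mI%:C) = 2 * rI -> normc (y - mJ%:C) <= 2 * rJ ->
    Lbound (Ry f g) i0 a b <= Uuy * normc (eval2 f x y) + Uvy * normc (eval2 g x y).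
  move=> ex ly; have lx : normc (x - mI%:C) <= 2 * rI by rewrite ex.
  apply: resultant_boundary facY admY ex (Ry_cofactors _ _ szY) _ _.
    by apply: bUuy; rewrite in_cdiscE.
  by apply: bUvy; rewrite in_cdiscE.
have bdX x y : normc (x - mI%:C) <= 2 * rI -> normc (y - mJ%:C) = 2 * rJ ->
    Lbound (Rx f g) j0 c d <= Uux * normc (eval2 f x y) + Uvx * normc (eval2 g x y).
  move=> lx ey; have ly : normc (y - mJ%:C) <= 2 * rJ by rewrite ey.
  apply: resultant_boundary facX admX ey (Rx_cofactors _ _ szX) _ _.
    by apply: bUux; rewrite in_cdiscE.
  by apply: bUvx; rewrite in_cdiscE.
have [z1 [z2 [[lz1 lz2] fz gz]]] := polydisc_common_zero (f := cpl f) (g := cpl g)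
  bdY bdX Uuy0 Uvy0 Uux0 Uvx0 (conj (ltW Dx0) (ltW Dy0)) S1 S2.
have {}fz : eval2 f z1 z2 = 0 by [].
have {}gz : eval2 g z1 z2 = 0 by [].
(* A common zero of f and g annihilates both resultants, and each has a single root in its disc. *)
have z1E : z1 = alpha%:C.
  case: facY => fact _ _; apply: (admissible_root_uniq fact admY lz1).
  by rewrite /intC (Ry_cofactors z1 z2 szY) fz gz !mulr0 addr0.
have z2E : z2 = beta%:C.
  case: facX => fact _ _; apply: (admissible_root_uniq fact admX lz2).
  by rewrite /intC (Rx_cofactors z1 z2 szX) fz gz !mulr0 addr0.
split; last by apply: complexI; rewrite -eval2_real -z1E -z2E fz.
(* The zero was found in the closed polydisc. On the boundary it would force a lower bound L <= 0,
   but L exceeds a nonnegative sum at (x0,y0). *)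
have S_ge0 U V : 0 <= U -> 0 <= V ->
    0 <= U * normc (eval2 f x0 y0) + V * normc (eval2 g x0 y0).
  by move=> U0 V0; rewrite addr_ge0 ?mulr_ge0 ?normc_ge0.
exists z1, z2; split=> //; rewrite in_discE lt_neqAle ?lz1 ?lz2 andbT; apply/eqP => ez.
  have := bdY _ _ ez lz2; rewrite fz gz normc0 !mulr0 addr0 leNgt => /negP; apply.
  exact: le_lt_trans (S_ge0 _ _ Uuy0 Uvy0) S1.
have := bdX _ _ lz1 ez; rewrite fz gz normc0 !mulr0 addr0 leNgt => /negP; apply.
exact: le_lt_trans (S_ge0 _ _ Uux0 Uvx0) S2.
Qed.
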